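(* There is a universal constant $C\le 384$ such that the following holds. Let $d\in\mathbb{N}$, $1\le p<q<\infty$, let $\nu$ be an absolutely continuous probability distribution on $\mathbb{R}$, and let $\mu$ be a probability measure on $\mathbb{R}^d$ with finite absolute $q$-moment $M_q(\mu)<\infty$. If $s>s^*_{pq/(q-p)}(\mu)$ (with $s$ a real number), then for all sufficiently large integers $W$ and $L$, $$ \mathcal{W}_p(\mu,\mathcal{NN}(W,L)_\# \nu) \le C\, d^{1/s}\,(M_q^p(\mu)+1)^{1/p}\,(W^2L)^{-1/s}. $$
   Context: $|\cdot|$ is the Euclidean norm. For a probability measure $\mu$ on $\mathbb{R}^d$, $M_q(\mu):=\left(\int_{\mathbb{R}^d}|x|^q\,d\mu(x)\right)^{1/q}$ and $M_q^p(\mu)=(M_q(\mu))^p$. ''Absolutely continuous'' means absolutely continuous with respect to Lebesgue measure. Covering numbers and upper dimension: for $S\subseteq\mathbb{R}^d$, $\mathcal{N}_\epsilon(S)$ is the smallest integer $m$ such that $S$ is covered by $m$ open Euclidean balls of radius $\epsilon$ with centers in $\mathbb{R}^d$ ($+\infty$ if there is none). For a probability measure $\mu$ on $\mathbb{R}^d$, $\mathcal{N}_\epsilon(\mu,\delta):=\inf\{\mathcal{N}_\epsilon(S):\mu(S)\ge 1-\delta\}$. For $1\le r<\infty$, the upper dimension is $$s^*_r(\mu):=\limsup_{\epsilon\to0}\frac{\log_2\mathcal{N}_\epsilon(\mu,\epsilon^r)}{-\log_2\epsilon}.$$ Neural networks: let $\sigma(x)=\max\{x,0\}$, applied element-wise.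 A ReLU neural network with $L$ hidden layers is a map $\phi:\mathbb{R}^{N_0}\to\mathbb{R}^{N_{L+1}}$ of the form $\phi = A_L\circ\sigma\circ A_{L-1}\circ\cdots\circ\sigma\circ A_0$, where $A_\ell(y)=M_\ell y+b_\ell$ is affine with $M_\ell\in\mathbb{R}^{N_{\ell+1}\times N_\ell}$, $b_\ell\in\mathbb{R}^{N_{\ell+1}}$. Its width is $\max_{1\le \ell\le L}N_\ell$ and its depth is $L$. Here $\mathcal{NN}(W,L)$ denotes the set of functions $\mathbb{R}\to\mathbb{R}^d$ representable by ReLU networks of width at most $W$ and depth at most $L$. The push-forward is $\phi_\#\nu(A)=\nu(\phi^{-1}(A))$. The Wasserstein distance is $\mathcal{W}_p(\mu,\gamma)=\inf_{\xi}\left(\int|x-y|^p\,d\xi(x,y)\right)^{1/p}$, the infimum being over all couplings $\xi$ of $\mu$ and $\gamma$. We write $\mathcal{W}_p(\mu,\mathcal{NN}(W,L)_\#\nu):=\inf_{\phi\in\mathcal{NN}(W,L)}\mathcal{W}_p(\mu,\phi_\#\nu)$. ''For all sufficiently large $W$ and $L$'' means: there are $W_0,L_0$ (which may depend on $\mu,p,q,s,d$) such that the bound holds for all $W\ge W_0$, $L\ge L_0$. *)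

(* Defs.v *)
From HB Require Import structures.
From mathcomp Require Import all_boot all_order all_algebra.
From mathcomp Require Import all_classical all_reals all_analysis.

Set Implicit Arguments.
Unset Strict Implicit.
Unset Printing Implicit Defensive.

Import Order.TTheory GRing.Theory Num.Theory.
Import numFieldNormedType.Exports.

Local Open Scope classical_set_scope.
Local Open Scope ring_scope.

(* R^d is represented by [d.-tuple R], because the library equips tuples (and
   not matrices) with the product sigma-algebra, which is the Borel
   sigma-algebra of R^d. *)
Notation Rd R d := (d.-tuple (measurableTypeR R)).

Section euclidean.
Context {R : realType} {d : nat}.

Definition enorm (x : Rd R d) : R := Num.sqrt (\sum_(i < d) tnth x i ^+ 2).

Definition edist (x y : Rd R d) : R :=
  enorm [tuple tnth x i - tnth y i | i < d].

Definition eball (c : Rd R d) (e : R) : set (Rd R d) :=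
  [set x | edist c x < e].

End euclidean.

Section covering_dimension.
Context {R : realType} {d : nat}.
Local Open Scope ereal_scope.

Definition covered_by (e : R) (S : set (Rd R d)) (m : nat) : Prop :=
  exists c : 'I_m -> Rd R d, S `<=` \bigcup_i eball (c i) e.

(* The infimum of the empty set is +oo, and the infimum of a nonempty set of
   natural numbers is attained. *)
Definition covering_number (e : R) (S : set (Rd R d)) : \bar R :=
  ereal_inf [set m%:R%:E | m in covered_by e S].

(* The infimum is over measurable sets, the only ones on which the values of
   [mu] are meaningful. *)
Definition measure_covering_number (mu : probability (Rd R d) R) (e delta : R)
    : \bar R :=
  ereal_inf [set covering_number e S |
    S in [set S | measurable S /\ (1 - delta)%:E <= mu S]].

Definition upper_dim (r : R) (mu : probability (Rd R d) R) : \bar R :=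
  limf_esup (fun e : R =>
    (lne (measure_covering_number mu e (e `^ r)) / (ln 2)%:E)
      / (- (ln e / ln 2))%:E) (0%R : R)^'+.

End covering_dimension.

Section moments_wasserstein.
Context {R : realType} {d : nat}.
Local Open Scope ereal_scope.

Definition moment (q : R) (mu : probability (Rd R d) R) : \bar R :=
  (\int[mu]_x ((enorm x) `^ q)%:E) `^ q^-1.

Definition coupling (mu gamma : set (Rd R d) -> \bar R)
    (xi : probability (Rd R d * Rd R d)%type R) : Prop :=
  forall A : set (Rd R d), measurable A ->
    pushforward xi fst A = mu A /\ pushforward xi snd A = gamma A.

(* The arguments are set functions rather than bundled measures, so that
   [pushforward nu phi] can be used directly. *)
Definition wasserstein (p : R) (mu gamma : set (Rd R d) -> \bar R) : \bar R :=
  ereal_inf [set (\int[xi]_z ((edist z.1 z.2) `^ p)%:E) `^ p^-1 |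
    xi in [set xi | coupling mu gamma xi]].

End moments_wasserstein.

Section relu_networks.
Context {R : realType}.

Definition relu {n : nat} (x : 'cV[R]_n) : 'cV[R]_n :=
  map_mx (fun t => Num.max t 0) x.

(* [relu_net m n] is the type of networks R^n -> R^m. The network
   A_L \o relu \o ... \o relu \o A_0 is [Layer A_0 (... (Output A_L))], with
   one [Layer] for each hidden layer. *)
Inductive relu_net (m : nat) : nat -> Type :=
| Output (n : nat) (M : 'M[R]_(m, n)) (b : 'cV[R]_m) : relu_net m n
| Layer (n k : nat) (M : 'M[R]_(k, n)) (b : 'cV[R]_k) (net : relu_net m k) :
    relu_net m n.

Fixpoint realize {m n : nat} (net : relu_net m n) : 'cV[R]_n -> 'cV[R]_m :=
  match net with
  | Output _ M b => fun x => M *m x + b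
  | Layer _ _ M b net' => fun x => realize net' (relu (M *m x + b))
  end.

Fixpoint depth {m n : nat} (net : relu_net m n) : nat :=
  match net with
  | Output _ _ _ => 0
  | Layer _ _ _ _ net' => (depth net').+1
  end.

Fixpoint width {m n : nat} (net : relu_net m n) : nat :=
  match net with
  | Output _ _ _ => 0
  | Layer _ k _ _ net' => maxn k (width net')
  end.

Definition NN (d W L : nat) : set (measurableTypeR R -> Rd R d) :=
  [set phi | exists net : relu_net d 1,
    [/\ (width net <= W)%N, (depth net <= L)%N &
        forall x, phi x = [tuple realize net (const_mx x) i 0 | i < d]]].

Definition wasserstein_NN {d : nat} (p : R) (mu : probability (Rd R d) R)
    (W L : nat) (nu : probability (measurableTypeR R) R) : \bar R :=
  ereal_inf [set wasserstein p mu (pushforward nu phi) | phi in @NN d W L].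

End relu_networks.

(* Main.v *)
From HB Require Import structures.
Require Import Defs.
From mathcomp Require Import all_boot all_order all_algebra.
From mathcomp Require Import all_classical all_reals all_analysis.
From mathcomp Require Import measurable_realfun.
From mathcomp Require Import zify ring lra.
Import Order.TTheory GRing.Theory Num.Theory.
Import numFieldNormedType.Exports.
Local Open Scope classical_set_scope.
Local Open Scope ring_scope.

(* Since s is strictly larger than the upper dimension, one can pick s' strictly
   between them: every constant is then absorbed for W and L large, and the
   theorem holds with C = 1.

   Put r = pq/(q-p). For small e there is a set A with mu(A) >= 1 - e^r covered
   by fewer than e^(-s') balls of radius e. Send the points of A to the centers
   of the balls and the other points to 0. Splitting at |x| = e^(-p/(q-p)), the
   integral of |x|^p over the complement of A is at most e^p (1 + M_q^q), so this
   discretization costs O(e) in W_p.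

   As nu has no atom, the line contains disjoint intervals whose nu-masses are
   (1 - th) times the weights of the discretization, separated by short
   transition intervals. A network that is equal to the i-th center on the i-th
   interval, and is bounded by a constant independent of th elsewhere, gives a
   coupling of cost O(e) as th tends to 0.

   Such a network is obtained by adding up blocks of three hidden layers, each
   of which produces of the order of W^2 steps: the first layer of a block
   selects one of W/c groups of consecutive steps, and for each group the second
   one produces W/c steps whose slopes and offsets depend on the group. Finally
   e = c' (W^2 L)^(-1/s) is large enough for the number of balls to be smaller
   than the number of steps, because s' < s. *)

Set Implicit Arguments.
Unset Strict Implicit.
Unset Printing Implicit Defensive.

(* MathComp-Analysis uses these two names for other notions. *)
Local Notation edist := Defs.edist.
Local Notation covered_by := Defs.covered_by.

(** * Step functions realized by ReLU networks *)

Section networks.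
Context {R : realType}.
Implicit Types (W L : nat) (t : R).

Definition relu1 (x : R) : R := Num.max x 0.

Lemma relu1_ge0 x : 0 <= x -> relu1 x = x.
Proof. by move=> x0; rewrite /relu1; case: (leP x 0) => // ?; lra. Qed.

Lemma relu1_le0 x : x <= 0 -> relu1 x = 0.
Proof. by move=> x0; rewrite /relu1; case: (leP x 0) => // ?; lra. Qed.

Lemma relu1_subN x : relu1 x - relu1 (- x) = x.
Proof. by have [x0|x0] := leP 0 x; [rewrite relu1_ge0// relu1_le0|rewrite relu1_le0 ?relu1_ge0]; lra. Qed.

(** The type of networks grows at the input end, whereas blocks are stacked at the output end: the
    former output layer becomes a hidden one. *)
Fixpoint add_layer {k m n : nat} (net : @relu_net R k n) (M : 'M[R]_(m, k))
    (b : 'cV[R]_m) : @relu_net R m n :=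
  match net with
  | Output _ A a => Layer A a (Output M b)
  | Layer _ _ A a net' => Layer A a (add_layer net' M b)
  end.

Lemma realize_add_layer k m n (net : @relu_net R k n) (M : 'M[R]_(m, k)) b x :
  realize (add_layer net M b) x = M *m relu (realize net x) + b.
Proof. by elim: net x => //= n' k' A a net IH x; rewrite IH. Qed.

Lemma depth_add_layer k m n (net : @relu_net R k n) (M : 'M[R]_(m, k)) b :
  depth (add_layer net M b) = (depth net).+1.
Proof. by elim: net => //= n' k' A a net ->. Qed.

Lemma width_add_layer k m n (net : @relu_net R k n) (M : 'M[R]_(m, k)) b :
  width (add_layer net M b) = maxn (width net) k.
Proof.
elim: net => /= [n' A a|n' k' A a net ->]; first by rewrite maxn0 max0n.
by rewrite maxnA.
Qed.

(* The values [f i t] are the outputs of a network before the activation. *)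
Definition computes W L (I : finType) (f : I -> R -> R) : Prop :=
  exists net : @relu_net R #|I| 1,
    [/\ (width net <= W)%N, (depth net <= L)%N &
        forall t i, realize net (const_mx t) (enum_rank i) 0 = f i t].

(** What a neuron of the next layer can receive before its activation, when [f] lists the values of
    the current layer before activation. *)
Definition relu_span (I : finType) (f : I -> R -> R) (h : R -> R) : Prop :=
  exists (M : I -> R) (b : R), forall t, h t = \sum_i M i * relu1 (f i t) + b.

Section span.
Context {I : finType} {f : I -> R -> R}.

Lemma relu_span_relu1 i : relu_span f (fun t => relu1 (f i t)).
Proof.
exists (fun j => (j == i)%:R), 0 => t; rewrite addr0 (bigD1 i)//= eqxx mul1r.
by rewrite big1 ?addr0// => j /negPf ->; rewrite mul0r.
Qed.

Lemma relu_span_cst c : relu_span f (fun=> c).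
Proof. by exists (fun=> 0), c => t; rewrite big1 ?add0r// => i _; rewrite mul0r. Qed.

Lemma relu_spanD g h : relu_span f g -> relu_span f h ->
  relu_span f (fun t => g t + h t).
Proof.
move=> [M [b Hg]] [M' [b' Hh]]; exists (fun i => M i + M' i), (b + b') => t.
rewrite Hg Hh addrACA -big_split/=; congr (_ + _).
by apply: eq_bigr => i _; rewrite mulrDl.
Qed.

Lemma relu_spanZ c g : relu_span f g -> relu_span f (fun t => c * g t).
Proof.
move=> [M [b Hg]]; exists (fun i => c * M i), (c * b) => t.
by rewrite Hg mulrDr mulr_sumr; congr (_ + _); apply: eq_bigr => i _; rewrite mulrA.
Qed.

Lemma relu_spanB g h : relu_span f g -> relu_span f h ->
  relu_span f (fun t => g t - h t).
Proof.
move=> Hg /(relu_spanZ (-1)) /(relu_spanD Hg) [M [b H]].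
by exists M, b => t; rewrite -H mulN1r.
Qed.

Lemma relu_span_sum (J : finType) (g : J -> R -> R) :
  (forall j, relu_span f (g j)) -> relu_span f (fun t => \sum_j g j t).
Proof.
move=> Hg; elim: (index_enum J) => [|j s IH].
  by have [M [b H]] := relu_span_cst 0; exists M, b => t; rewrite big_nil.
by have [M [b H]] := relu_spanD (Hg j) IH; exists M, b => t; rewrite big_cons.
Qed.

Lemma eq_relu_span g h : g =1 h -> relu_span f g -> relu_span f h.
Proof. by move=> gh [M [b H]]; exists M, b => t; rewrite -gh. Qed.

End span.

Lemma computes_layer W L (I J : finType) (f : I -> R -> R) (g : J -> R -> R) :
  computes W L f -> (#|I| <= W)%N -> (forall j, relu_span f (g j)) ->
  computes W L.+1 g.
Proof.
move=> [net [wn dn Hf]] IW /choice[M /choice[b Hg]].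
exists (add_layer net (\matrix_(j, i) M (enum_val j) (enum_val i))
  (\col_j b (enum_val j))); split.
- by rewrite width_add_layer geq_max wn.
- by rewrite depth_add_layer ltnS.
move=> t j; rewrite realize_add_layer Hg !mxE enum_rankK; congr (_ + _).
rewrite (reindex_onto enum_rank enum_val)/=; last by move=> i _; rewrite enum_valK.
apply: eq_big => [i|i _]; first by rewrite enum_rankK eqxx.
by rewrite !mxE !enum_rankK Hf.
Qed.

Lemma computes_affine W (I : finType) (al be : I -> R) :
  computes W 0 (fun i t => al i * t + be i).
Proof.
exists (Output (\matrix_(i, j) al (enum_val i)) (\col_i be (enum_val i))).
by split => // t i; rewrite /= !mxE big_ord1 !mxE !enum_rankK.
Qed.

Lemma NN_relu_span W L d (I : finType) (f : I -> R -> R) (g : 'I_d -> R -> R) :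
  computes W L f -> (#|I| <= W)%N -> (forall j, relu_span f (g j)) ->
  NN W L.+1 (fun t : measurableTypeR R => [tuple g j t | j < d]).
Proof.
move=> [net [wn dn Hf]] IW /choice[M /choice[b Hg]].
exists (add_layer net (\matrix_(j, i) M j (enum_val i)) (\col_j b j)); split.
- by rewrite width_add_layer geq_max wn.
- by rewrite depth_add_layer ltnS.
move=> t; apply: eq_from_tnth => j; rewrite !tnth_mktuple.
rewrite realize_add_layer Hg !mxE; congr (_ + _).
rewrite [RHS](reindex_onto enum_rank enum_val)/=; last by move=> i _; rewrite enum_valK.
apply: eq_big => [i|i _]; first by rewrite enum_rankK eqxx.
by rewrite !mxE !enum_rankK Hf.
Qed.

(** The first coefficient is the slope leading from 0 at [b] to [al * a + be] at [a]; the second one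
    corrects the slope to [al] beyond [a]. *)
Lemma hinge (b a al be : R) : b < a -> exists c1 c2 : R, forall t,
  (t <= b -> c1 * relu1 (t - b) + c2 * relu1 (t - a) = 0) /\
  (a <= t -> c1 * relu1 (t - b) + c2 * relu1 (t - a) = al * t + be).
Proof.
move=> ba; have ab0 : a - b != 0 by lra.
exists ((al * a + be) / (a - b)), (al - (al * a + be) / (a - b)) => t; split=> h.
  by rewrite !relu1_le0; lra.
rewrite !relu1_ge0; [field; exact: ab0|lra|lra].
Qed.

Lemma telescope_lt (D : nat -> R) n r :
  \sum_(k < n) (D k.+1 - D k) * (k < r)%N%:R = D (minn n r) - D 0%N.
Proof.
elim: n => [|n IH]; first by rewrite big_ord0 min0n subrr.
rewrite big_ord_recr/= IH; case: (ltnP n r) => nr.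
  by rewrite mulr1 (minn_idPl nr); ring.
by rewrite mulr0 addr0 (minn_idPr (leqW nr)).
Qed.

(* [t] lies beyond the [l] first transition intervals [b i, a i] and before
   the next ones. *)
Definition located (N : nat) (a b : nat -> R) (l : nat) t : Prop :=
  forall i, (i < N)%N -> ((i < l)%N -> a i <= t) /\ ((l <= i)%N -> t <= b i).

Section staircase.
Variables (N : nat) (a b : nat -> R).
Hypothesis ba : forall i, b i < a i.

(** Group [j] begins at transition [o + j * n], where a hinge adds the difference between the affine
    functions number [j] and [j.+1]; the sum telescopes. The kinks do not depend on [al] and [be],
    so the same [m + m] neurons serve all choices of them. Index 0 stands for no group. *)
Lemma select_affine o m n (al be : nat -> R) : (o + m * n <= N)%N -> (0 < n)%N ->
  al 0%N = 0 -> be 0%N = 0 ->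
  exists c1 c2 : nat -> R, forall t l J, located N a b l t -> (J <= m)%N ->
    (forall j, (j < m)%N -> (o + j * n < l)%N = (j < J)%N) ->
    \sum_(j < m) (c1 j * relu1 (t - b (o + j * n)%N) +
                  c2 j * relu1 (t - a (o + j * n)%N)) = al J * t + be J.
Proof.
move=> omn n0 al0 be0.
have /choice[c1 /choice[c2 Hc]] : forall j, exists c1 c2, forall t,
    (t <= b (o + j * n)%N ->
      c1 * relu1 (t - b (o + j * n)%N) + c2 * relu1 (t - a (o + j * n)%N) = 0) /\
    (a (o + j * n)%N <= t ->
      c1 * relu1 (t - b (o + j * n)%N) + c2 * relu1 (t - a (o + j * n)%N) =
      (al j.+1 - al j) * t + (be j.+1 - be j)).
  by move=> j; exact: hinge.
exists c1, c2 => t l J lt Jm HJ.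
transitivity (\sum_(j < m) ((al j.+1 * t + be j.+1) - (al j * t + be j))
    * (j < J)%N%:R).
  apply: eq_bigr => j _.
  have jN : (o + j * n < N)%N.
    by rewrite (leq_trans _ omn)// ltn_add2l ltn_pmul2r.
  have [lt1 lt2] := lt _ jN; have [H1 H2] := Hc j t.
  rewrite -HJ//; case: ltnP => h; last by rewrite H1 ?mulr0//; exact: lt2.
  by rewrite H2 ?lt1// mulr1; ring.
rewrite (telescope_lt (fun j => al j * t + be j)) (minn_idPr Jm) al0 be0.
by rewrite mul0r !addr0 subr0.
Qed.

Lemma group_index o m n l : exists2 J, (J <= m)%N &
  forall j, (j < m)%N -> (o + j * n < l)%N = (j < J)%N.
Proof.
elim: m => [|m [J Jm HJ]]; first by exists 0%N.
have [h|h] := ltnP (o + m * n)%N l.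
  exists m.+1 => // j jm; rewrite jm; apply: leq_ltn_trans h.
  by rewrite leq_add2l leq_mul2r -ltnS jm orbT.
exists J; first exact: leqW.
move=> j; rewrite ltnS leq_eqVlt => /orP[/eqP ->|]; last exact: HJ.
by rewrite !ltnNge h Jm.
Qed.

Section block.
Context {d : nat}.
Variable C : nat -> 'I_d -> R.

(** To pass through the activation, the input [t] (the case [None]) and the partial sums [y] are
    carried with both signs, as [relu1 x - relu1 (- x) = x]. *)
Definition state (y : 'I_d -> R -> R) (x : bool * option 'I_d) t : R :=
  (if x.1 then 1 else -1) * (if x.2 is Some i then y i t else t).

Lemma card_state : #|{: bool * option 'I_d}| = (d.+1).*2.
Proof. by rewrite card_prod card_bool card_option card_ord mul2n. Qed.

Lemma state_spans y (I : finType) (f : I -> R -> R) (e : bool * option 'I_d -> I) :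
  (forall u, f (e u) =1 state y u) ->
  relu_span f id /\ forall i, relu_span f (y i).
Proof.
move=> fe; split=> [|i].
  apply: (@eq_relu_span _ _ (fun t => relu1 (f (e (true, None)) t) -
      relu1 (f (e (false, None)) t))); last exact/relu_spanB/relu_span_relu1/relu_span_relu1.
  by move=> t; rewrite !fe /state/= mul1r mulN1r relu1_subN.
apply: (@eq_relu_span _ _ (fun t => relu1 (f (e (true, Some i)) t) -
    relu1 (f (e (false, Some i)) t))); last exact/relu_spanB/relu_span_relu1/relu_span_relu1.
by move=> t; rewrite !fe /state/= mul1r mulN1r relu1_subN.
Qed.

Lemma relu_span_state y (I : finType) (f : I -> R -> R) :
  relu_span f id -> (forall i, relu_span f (y i)) ->
  forall u, relu_span f (state y u).
Proof. by move=> ft fy [s [i|]]; exact: relu_spanZ. Qed.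

(* Two hidden layers suffice to select, with [2 * m] and [4 * n * d] neurons,
   the level of [t] among [m * n] steps: the first one makes the slope and the
   offset of the ramps of the second one depend on the group of [n] consecutive
   steps to which [t] belongs. *)
Lemma computes_block W L (y : 'I_d -> R -> R) o m n :
  (0 < n)%N -> (o + m * n <= N)%N ->
  ((d.+1).*2 + (m + m) <= W)%N -> ((d.+1).*2 + n.*2.*2 * d <= W)%N ->
  computes W L (state y) ->
  exists2 G : 'I_d -> R -> R,
    computes W L.+3 (state (fun i t => y i t + G i t)) &
    forall i t l, located N a b l t ->
      G i t = C (minn l (o + m * n)) i - C (minn l o) i.
Proof.
move=> n0 omn Wm Wn Hy.
(* In group [J] the ramps of the other groups are switched off, so its first ramp has to jump from
   the level [C o] at the entrance of the block, and not from the last level of the preceding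
   group. *)
pose D i J k := if k == 0%N then C o i else C (o + J * n + k)%N i.
pose idx J k := (o + J * n + k)%N.
(* Slope, over one transition interval, of the positive or negative part of the jump, according to
   [s]. It is nonnegative and thus comes out of [relu1]; [e] tells whether the kink is at the end or
   at the beginning of the interval. *)
pose sl (s : bool) i J k := relu1 ((-1) ^+ s * (D i J k.+1 - D i J k)) / (a (idx J k) - b (idx J k)).
pose al (z : 'I_d * 'I_n * bool * bool) J :=
  let: (i, k, s, e) := z in if J is J'.+1 then sl s i J' k else 0.
pose be (z : 'I_d * 'I_n * bool * bool) J :=
  let: (i, k, s, e) := z in
  if J is J'.+1 then - sl s i J' k * (if e then a (idx J' k) else b (idx J' k)) else 0.
have /choice[c1 /choice[c2 Hq]] := fun z => @select_affine o m n (al z) (be z) omn n0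
  ltac:(by case: z => [[[? ?] ?] ?]) ltac:(by case: z => [[[? ?] ?] ?]).
pose q z t := \sum_(j < m) (c1 z j * relu1 (t - b (o + j * n)%N) +
                  c2 z j * relu1 (t - a (o + j * n)%N)).
pose f1 (x : (bool * option 'I_d) + ('I_m + 'I_m)) t := match x with
  | inl u => state y u t
  | inr (inl j) => t - b (o + j * n)%N
  | inr (inr j) => t - a (o + j * n)%N end.
pose f2 (x : (bool * option 'I_d) + ('I_d * 'I_n * bool * bool)) t := match x with
  | inl u => state y u t
  | inr z => q z t end.
pose G i t := \sum_(k < n) \sum_(s : bool) \sum_(e : bool)
  ((-1) ^+ s * (-1) ^+ e) * relu1 (q (i, k, s, e) t).
have c_f1 : computes W L.+1 f1.
  have [sp_t sp_y] := @state_spans y _ (state y) id (fun _ _ => erefl).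
  apply: (computes_layer Hy).
    by rewrite card_state (leq_trans _ Wm)// leq_addr.
  move=> [u|[j|j]]; first exact: relu_span_state.
  - exact: (relu_spanB sp_t (relu_span_cst _)).
  - exact: (relu_spanB sp_t (relu_span_cst _)).
have c_f2 : computes W L.+2 f2.
  have [sp_t sp_y] := @state_spans y _ f1 inl (fun _ _ => erefl).
  apply: (computes_layer c_f1).
    by rewrite !card_sum card_state !card_ord.
  move=> [u|z]; first exact: relu_span_state.
  apply: relu_span_sum => j; apply: relu_spanD; apply: relu_spanZ.
    exact: (relu_span_relu1 (inr (inl j))).
  exact: (relu_span_relu1 (inr (inr j))).
exists G.
  have [sp_t sp_y] := @state_spans y _ f2 inl (fun _ _ => erefl).
  apply: (computes_layer c_f2).
    rewrite card_sum card_state !card_prod !card_ord !card_bool.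
    by apply: leq_trans Wn; rewrite leq_add2l; lia.
  apply: relu_span_state => // i; apply: relu_spanD => //.
  do 3![apply: relu_span_sum => ?]; apply: relu_spanZ.
  exact: (relu_span_relu1 (inr _)).
move=> i t l lt.
have [J Jm HJ] := group_index o m n l.
have {}Hq z : q z t = al z J * t + be z J by exact: Hq lt Jm HJ.
rewrite /G; under eq_bigr do under eq_bigr do under eq_bigr do rewrite Hq.
case: J Jm HJ {Hq} => [|J] Jm HJ.
  rewrite big1 => [|k _]; last first.
    rewrite big1// => s _; rewrite big1// => e _.
    by rewrite /= mul0r addr0 relu1_le0 ?mulr0.
  have [->|m0] := posnP m; first by rewrite mul0n addn0 subrr.
  have lo : (l <= o)%N.
    by have := HJ 0%N m0; rewrite mul0n addn0 ltn0 => /negbT; rewrite -leqNgt.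
  by rewrite !(minn_idPl _)// ?subrr// (leq_trans lo)// leq_addr.
have oJl : (o + J * n < l)%N by rewrite HJ// ltnS.
have sl_ge0 s k : 0 <= sl s i J k.
  rewrite /sl divr_ge0//; first by rewrite /relu1 le_max lexx orbT.
  by rewrite subr_ge0 ltW.
transitivity (\sum_(k < n) (D i J k.+1 - D i J k) * (k < l - (o + J * n))%N%:R).
  apply: eq_bigr => k _.
  have kN : (idx J k < N)%N.
    apply: leq_trans omn; rewrite /idx -addnA ltn_add2l.
    apply: (@leq_trans (J.+1 * n)); first by rewrite mulSn addnC ltn_add2r.
    by rewrite leq_mul2r Jm orbT.
  have rlq s u : relu1 (sl s i J k * t + - sl s i J k * u) = sl s i J k * relu1 (t - u).
    rewrite mulNr -mulrBr; have [tu|tu] := leP 0 (t - u).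
      by rewrite !relu1_ge0// mulr_ge0.
    by rewrite !relu1_le0 ?mulr0 ?(ltW tu)// mulr_ge0_le0// ltW.
  rewrite !big_bool/= !rlq !expr0 !expr1 /sl !expr0 !expr1 !mul1r !mulN1r.
  set D' := D i J k.+1 - _.
  have DE : D' = relu1 D' - relu1 (- D') by rewrite relu1_subN.
  have ab0 : a (idx J k) - b (idx J k) != 0 by rewrite subr_eq0 gt_eqF.
  rewrite ltn_subRL -/(idx J k); have [/(_ _)lt1 lt2] := lt _ kN.
  case: ltnP => h.
    have ta := lt1 h; have := ba (idx J k) => ba'.
    have -> : relu1 (t - b (idx J k)) = t - b (idx J k) by apply: relu1_ge0; lra.
    have -> : relu1 (t - a (idx J k)) = t - a (idx J k) by apply: relu1_ge0; lra.
    by rewrite mulr1 [RHS]DE; field.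
  have tb := lt2 h; have := ba (idx J k) => ba'.
  have -> : relu1 (t - b (idx J k)) = 0 by apply: relu1_le0; lra.
  have -> : relu1 (t - a (idx J k)) = 0 by apply: relu1_le0; lra.
  by rewrite !mulr0; ring.
rewrite (telescope_lt (D i J)) {2}/D eqxx {1}/D.
rewrite (minn_idPr (ltnW (leq_ltn_trans (leq_addr _ _) oJl))).
(* The current group has passed at least one transition, so the upper end of the telescope is not
   the exceptional entry of [D]. *)
have -> : (minn n (l - (o + J * n)) == 0)%N = false.
  by rewrite minnE; lia.
congr (C _ i - _).
(* Unless group [J] is the last one, the next has not begun, which bounds [l] by the end of group
   [J]; in the last group both sides are truncated at the end of the block. *)
have [Jm'|Jm'] := ltnP J.+1 m.
  have := HJ J.+1 Jm'; rewrite ltnn => /negbT; rewrite -leqNgt mulSn => lo.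
  have : (J.+2 * n <= m * n)%N by rewrite leq_mul2r Jm' orbT.
  by rewrite !mulSn => ?; lia.
have -> : m = J.+1 by apply/eqP; rewrite eqn_leq Jm Jm'.
by rewrite mulSn; lia.
Qed.

End block.
End staircase.
End networks.

(** * Stacking of the blocks and truncation of the output *)

Section staircase.
Context {R : realType} {d : nat}.

Lemma eq_computes W L (I : finType) (f g : I -> R -> R) :
  f =2 g -> computes W L f -> computes W L g.
Proof. by move=> fg [net [? ? H]]; exists net; split=> // t i; rewrite -fg. Qed.

Variables (N : nat) (a b : nat -> R) (C : nat -> 'I_d -> R).
Hypothesis ba : forall i, b i < a i.
Hypothesis C0 : forall i, C 0%N i = 0.

Lemma computes_blocks W B m n : (0 < n)%N -> (B * (m * n) <= N)%N ->
  ((d.+1).*2 + (m + m) <= W)%N -> ((d.+1).*2 + n.*2.*2 * d <= W)%N ->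
  exists2 y : 'I_d -> R -> R, computes W (3 * B) (state y) &
    forall i t l, located N a b l t -> y i t = C (minn l (B * (m * n))) i.
Proof.
move=> n0 BN Wm Wn; elim: B BN => [|B IH] BN.
  exists (fun _ _ => 0); last by move=> i t l _; rewrite mul0n minn0 C0.
  apply: eq_computes (computes_affine W
    (fun x : bool * option 'I_d =>
      (if x.1 then 1 else -1) * (if x.2 is Some _ then 0 else 1)) (fun=> 0)).
  by move=> [s [i|]] t; rewrite /state/=; ring.
have [|y Hy yE] := IH; first by apply: leq_trans BN; rewrite mulSn leq_addl.
have BN' : (B * (m * n) + m * n <= N)%N by rewrite addnC -mulSn.
have [G HG GE] := computes_block ba C n0 BN' Wm Wn Hy.
exists (fun i t => y i t + G i t); first by rewrite mulnS.
by move=> i t l lt; rewrite (yE _ _ _ lt) (GE _ _ _ lt) mulSn [(m * n + _)%N]addnC; ring.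
Qed.

(** The values inside the transition intervals are not controlled, so a last layer projects every
    coordinate to [[-K, K]], which leaves the levels of the staircase unchanged. The depth
    [3 * B + 2] counts the final [state] and this truncation as hidden layers. *)
Lemma NN_staircase W L B m n K : (0 < n)%N -> (B * (m * n) = N)%N ->
  ((d.+1).*2 + (m + m) <= W)%N -> ((d.+1).*2 + n.*2.*2 * d <= W)%N ->
  (3 * B + 2 <= L)%N -> (forall j i, `|C j i| <= K) ->
  exists2 phi, @NN R d W L phi & (forall t i, `|tnth (phi t) i| <= K) /\
    forall i t l, located N a b l t -> tnth (phi t) i = C (minn l N) i.
Proof.
move=> n0 BN Wm Wn BL CK.
have [|y Hy yE] := @computes_blocks W B m n n0 _ Wm Wn; first by rewrite BN.
have W1 : ((d.+1).*2 <= W)%N by rewrite (leq_trans _ Wm)// leq_addr.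
pose f (x : 'I_d * bool) t := y x.1 t + (if x.2 then K else - K).
have Hf : computes W (3 * B).+1 f.
  have [sp_t sp_y] := @state_spans _ _ y _ (state y) id (fun _ _ => erefl).
  apply: (computes_layer Hy); first by rewrite card_state.
  by move=> [i s]; apply: (relu_spanD (sp_y i)); exact: relu_span_cst.
pose g i t := relu1 (f (i, true) t) - relu1 (f (i, false) t) - K.
have Hg i : relu_span f (g i).
  apply: relu_spanB (relu_span_cst K).
  exact: relu_spanB (relu_span_relu1 (i, true)) (relu_span_relu1 (i, false)).
have gE i t : g i t = relu1 (y i t + K) - relu1 (y i t - K) - K by [].
have {}gE i t : 0 <= K -> `|g i t| <= K /\ (`|y i t| <= K -> g i t = y i t).
  move=> K0; rewrite gE !ler_norml.
  have [h1|h1] := leP 0 (y i t + K); have [h2|h2] := leP 0 (y i t - K);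
    rewrite ?(relu1_ge0 h1) ?(relu1_ge0 h2) ?(relu1_le0 (ltW h1)) ?(relu1_le0 (ltW h2));
    split=> [|/andP[? ?]]; try (apply/andP; split); lra.
exists (fun t => [tuple g j t | j < d]).
  have [|net [wn dn H]] := NN_relu_span Hf _ Hg.
    by rewrite card_prod card_ord card_bool; lia.
  by exists net; split=> //; apply: leq_trans dn _; lia.
split=> [t i|i t l lt].
  by rewrite tnth_mktuple; have [] := gE i t (le_trans (normr_ge0 _) (CK 0%N i)).
rewrite tnth_mktuple; have [_ ->] := gE i t (le_trans (normr_ge0 _) (CK 0%N i)).
  by rewrite (yE _ _ _ lt) BN.
by rewrite (yE _ _ _ lt).
Qed.

End staircase.

(** * Measurability of networks *)

Section measurability.
Context {R : realType}.

Lemma measurable_realize m n (net : @relu_net R m n) (u : R -> 'cV[R]_n) :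
  (forall j, measurable_fun setT (fun t => u t j 0)) ->
  forall i, measurable_fun setT (fun t => realize net (u t) i 0).
Proof.
have aff k l (A : 'M[R]_(k, l)) (c : 'cV[R]_k) (v : R -> 'cV[R]_l) :
    (forall j, measurable_fun setT (fun t => v t j 0)) ->
    forall i, measurable_fun setT (fun t => (A *m v t + c) i 0).
  move=> mv i; under eq_fun do rewrite !mxE.
  apply: measurable_funD; last exact: measurable_cst.
  by apply: measurable_sum => j; apply: measurable_funM => //; exact: measurable_cst.
elim: net u => [k A c u mu|k l A c net IH u mu] i /=; first exact: aff.
apply: IH => j; under eq_fun do rewrite mxE.
by apply: measurable_maxr; [exact: aff|exact: measurable_cst].
Qed.

Lemma measurable_NN d W L phi : @NN R d W L phi -> measurable_fun setT phi.
Proof.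
move=> [net [_ _ E]]; apply/measurable_fun_tnthP => i.
rewrite (_ : _ \o _ = fun x => realize net (const_mx x) i 0); last first.
  by apply/funext => x; rewrite /= E tnth_mktuple.
apply: measurable_realize => j; under eq_fun do rewrite mxE.
exact: measurable_id.
Qed.

End measurability.

(** * A coupling concentrated near the diagonal *)

Section near_diagonal_coupling.
Context {d1 d2 : measure_display} {X : measurableType d1} {Y : measurableType d2}.
Context {R : realType} (mu : probability X R) (nu : probability Y R).
Local Open Scope ereal_scope.
Variables (N : nat) (S : nat -> set X) (K : nat -> set Y) (th : R).
Hypotheses (mS : forall i, measurable (S i)) (mK : forall i, measurable (K i)).
Hypotheses (tS : trivIset setT S) (tK : trivIset setT K).
Hypothesis covS : \big[setU/set0]_(i < N) S i = setT.
Hypothesis nuK : forall i, nu (K i) = (1 - th)%:E * mu (S i).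

Let KN := \big[setU/set0]_(i < N) K i.

Let mKN : measurable KN.
Proof. exact: bigsetU_measurable. Qed.

Let sum_muS A : measurable A -> \sum_(i < N) mu (A `&` S i) = mu A.
Proof.
move=> mA; rewrite -(@measure_bigsetU _ _ _ mu (fun i => A `&` S i)); first last.
- exact: trivIset_setIl.
- by move=> i; exact: measurableI.
by rewrite -big_distrr/= covS setIT.
Qed.

Let sum_nuK B : measurable B -> \sum_(i < N) nu (B `&` K i) + nu (B `&` ~` KN) = nu B.
Proof.
move=> mB; rewrite -(@measure_bigsetU _ _ _ nu (fun i => B `&` K i)); first last.
- exact: trivIset_setIl.
- by move=> i; exact: measurableI.
by rewrite -big_distrr/= [RHS](measureDI nu mB mKN) addeC setDE.
Qed.

Let nuJ : nu (~` KN) = th%:E.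
Proof.
have := sum_nuK measurableT; under eq_bigr do rewrite setTI nuK.
rewrite setTI -ge0_sume_distrr//.
have := sum_muS measurableT; under eq_bigr do rewrite setTI.
rewrite !probability_setT => ->; rewrite mule1.
have : nu (~` KN) \is a fin_num by apply/fin_num_measure/measurableC.
by move/fineK <-; rewrite -EFinD => -[] h; congr EFin; lra.
Qed.

Let al i : {nonneg R} := NngNum (ltac:(rewrite invr_ge0 fine_ge0//) : 0 <= (fine (mu (S i)))^-1)%R.

(** This includes pieces of mass zero: the inverse of 0 is 0, and the intersection of [A] with [S i]
    is then null too. *)
Let alP A i : measurable A -> (al i)%:num%:E * (mu (A `&` S i) * mu (S i)) = mu (A `&` S i).
Proof.
move=> mA /=.
have : mu (A `&` S i) <= mu (S i).
  by rewrite le_measure ?inE//; exact: measurableI.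
have : mu (A `&` S i) \is a fin_num by exact/fin_num_measure/measurableI.
have : mu (S i) \is a fin_num by exact/fin_num_measure.
move=> /fineK <- /fineK <-; rewrite lee_fin -!EFinM/= => le; congr EFin.
have [z|nz] := eqVneq (fine (mu (S i))) 0%R; last by field.
rewrite z mulr0 mulr0; apply/esym/eqP; rewrite eq_le -{1}z le/=.
by rewrite fine_ge0.
Qed.

(* The conditional laws of [mu] on [S i] and of [nu] on [K i] are made
   independent. The part of [nu] outside the [K i] is coupled independently
   with [mu], at the price of the mass [th]. *)
Let z1 : {measure set (X * Y) -> \bar R} :=
  msum (fun i => mscale (al i) (mrestr (mu \x nu) (measurableX (mS i) (mK i)))) N.
Let z2 : {measure set (X * Y) -> \bar R} :=
  mrestr (mu \x nu) (measurableX (@measurableT _ X) (measurableC mKN)).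

Let restrE (S' A : set X) (K' B : set Y) (mS' : measurable S') (mK' : measurable K') :
  measurable A -> measurable B ->
  mrestr (mu \x nu) (measurableX mS' mK') (A `*` B) = mu (A `&` S') * nu (B `&` K').
Proof.
move=> mA mB; rewrite /mrestr -setXI.
by apply: product_measure1E; exact: measurableI.
Qed.

Lemma near_diagonal_coupling :
  exists z1 z2 : {measure set (X * Y) -> \bar R},
  [/\ forall A, measurable A -> z1 (A `*` setT) = (1 - th)%:E * mu A,
      forall A, measurable A -> z2 (A `*` setT) = th%:E * mu A,
      forall B, measurable B -> z1 (setT `*` B) + z2 (setT `*` B) = nu B &
      z1 (~` \big[setU/set0]_(i < N) (S i `*` K i)) = 0].
Proof.
exists z1, z2; split.
- move=> A mA; rewrite /z1/= /msum/= /mscale/= -sum_muS// ge0_sume_distrr//.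
  apply: eq_bigr => i _; rewrite restrE// setTI nuK.
  by rewrite -[in RHS]alP// [in RHS]muleCA [in LHS](muleCA (mu _)).
- by move=> A mA; rewrite /z2/= restrE// setTI setIT nuJ muleC.
- move=> B mB; rewrite -[RHS]sum_nuK// /z1/= /msum/= /mscale/=; congr +%E.
    apply: eq_bigr => i _; rewrite restrE// setTI.
    have [z|nz] := eqVneq (mu (S i)) 0.
      rewrite z mul0e mule0; apply/esym/eqP; rewrite -measure_le0.
      rewrite (_ : 0 = nu (K i)); last by rewrite nuK z mule0.
      by rewrite le_measure ?inE//; exact: measurableI.
    rewrite muleA /=.
    have : mu (S i) \is a fin_num by exact/fin_num_measure.
    move=> /[dup] fS /fineK E; rewrite -{2}E -EFinM mulVf ?mul1e//.
    by rewrite -eqe E.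
  by rewrite /z2/= restrE// setTI probability_setT mul1e.
rewrite /z1/= /msum/= /mscale/= big1// => i _.
rewrite /mrestr (_ : _ `&` _ = set0) ?measure0 ?mule0//.
apply/seteqP; split=> // x [nx Sx]; apply: nx.
by rewrite -(bigcup_mkord N (fun i => S i `*` K i)); exists i => //=.
Qed.

End near_diagonal_coupling.

(** * Euclidean norm and distance *)

Section euclidean.
Context {R : realType} {d : nat}.
Implicit Types x y : Rd R d.

Lemma enorm_ge0 x : 0 <= enorm x.
Proof. exact: sqrtr_ge0. Qed.

Lemma edist_ge0 x y : 0 <= edist x y.
Proof. exact: enorm_ge0. Qed.

Lemma measurable_edist d1 (T : measurableType d1) (f g : T -> Rd R d) :
  measurable_fun setT f -> measurable_fun setT g ->
  measurable_fun setT (fun z => edist (f z) (g z)).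
Proof.
move=> /measurable_fun_tnthP mf /measurable_fun_tnthP mg.
apply: (measurableT_comp (continuous_measurable_fun (@sqrt_continuous R))).
apply: measurable_sum => i; under eq_fun do rewrite tnth_mktuple.
by apply/measurable_funX/measurable_funB; [exact: mf|exact: mg].
Qed.

Lemma edistC x y : edist x y = edist y x.
Proof.
by congr Num.sqrt; apply: eq_bigr => i _; rewrite !tnth_mktuple -sqrrN opprB.
Qed.

Lemma edist0 x : edist x [tuple 0 | i < d] = enorm x.
Proof.
by congr Num.sqrt; apply: eq_bigr => i _; rewrite !tnth_mktuple subr0.
Qed.

Lemma measurable_enorm : measurable_fun setT (@enorm R d).
Proof.
rewrite (_ : @enorm R d = fun x => edist x [tuple 0 | i < d]).
  by apply: measurable_edist; [exact: measurable_id|exact: measurable_cst].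
by apply/funext => x; rewrite edist0.
Qed.

(** Coordinatewise, (a - b)^2 is at most 2 a^2 + 2 b^2, because the difference is (a + b)^2. *)
Lemma edist_le x y : edist x y <= 2 * Num.max (enorm x) (enorm y).
Proof.
set M := Num.max _ _.
have M0 : 0 <= M by rewrite le_max enorm_ge0.
have sq z : enorm z ^+ 2 = \sum_(i < d) tnth z i ^+ 2.
  by rewrite sqr_sqrtr// sumr_ge0// => i _; exact: sqr_ge0.
rewrite -(@ler_pXn2r _ 2)// ?nnegrE ?edist_ge0 ?mulr_ge0// sq.
apply: (@le_trans _ _ (2 * enorm x ^+ 2 + 2 * enorm y ^+ 2)).
  rewrite !sq !mulr_sumr -big_split/=; apply: ler_sum => i _.
  rewrite tnth_mktuple -subr_ge0.
  set a := tnth x i; set b := tnth y i.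
  have -> : 2 * a ^+ 2 + 2 * b ^+ 2 - (a - b) ^+ 2 = (a + b) ^+ 2 by ring.
  exact: sqr_ge0.
have xM : enorm x ^+ 2 <= M ^+ 2 by rewrite ler_pXn2r ?nnegrE ?enorm_ge0// le_max lexx.
have yM : enorm y ^+ 2 <= M ^+ 2 by rewrite ler_pXn2r ?nnegrE ?enorm_ge0// le_max lexx orbT.
by rewrite exprMn; lra.
Qed.

Lemma edist_powR_le p x y : 0 <= p ->
  edist x y `^ p <= 2 `^ p * (enorm x `^ p + enorm y `^ p).
Proof.
move=> p0; apply: (@le_trans _ _ ((2 * Num.max (enorm x) (enorm y)) `^ p)).
  rewrite ge0_ler_powR ?nnegrE ?edist_ge0 ?edist_le//.
  by rewrite mulr_ge0// le_max enorm_ge0.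
rewrite powRM// ?le_max ?enorm_ge0// ler_wpM2l ?powR_ge0//.
by case: (leP (enorm x)) => _; rewrite ?lerDl ?lerDr powR_ge0.
Qed.

End euclidean.

(** * Wasserstein bound from the coupling *)

Section wasserstein_upper_bound.
Context {R : realType}.
Local Open Scope ereal_scope.

Lemma integral_marginal d1 d2 (X : measurableType d1) (Y : measurableType d2)
    (mu : {measure set X -> \bar R}) (z : {measure set (X * Y) -> \bar R}) (k : R)
    (g : X -> \bar R) :
  (0 <= k)%R -> (forall A, measurable A -> z (A `*` setT) = k%:E * mu A) ->
  measurable_fun setT g -> (forall x, 0 <= g x) ->
  \int[z]_w g w.1 = k%:E * \int[mu]_x g x.
Proof.
move=> k0 zE mg g0.
rewrite -[LHS](@ge0_integral_pushforward _ _ _ _ _ _ measurable_fst z setT g)//.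
rewrite -[k]/((NngNum k0)%:num)%R -(ge0_integral_mscale mu)//.
apply: eq_measure_integral => A mA _; rewrite /= /mscale -zE// /pushforward.
by rewrite setXT.
Qed.

Context {d : nat} (mu : probability (Rd R d) R) (nu : probability (measurableTypeR R) R).
Variables (N : nat) (S : nat -> set (Rd R d)) (K : nat -> set (measurableTypeR R)).
Variables (th : R) (phi : measurableTypeR R -> Rd R d) (p : R).
Variables g h : Rd R d -> R.
Hypotheses (th0 : (0 <= th)%R) (th1 : (th <= 1)%R).
Hypotheses (mS : forall i, measurable (S i)) (mK : forall i, measurable (K i)).
Hypotheses (tS : trivIset setT S) (tK : trivIset setT K).
Hypothesis covS : \big[setU/set0]_(i < N) S i = setT.
Hypothesis nuK : forall i, nu (K i) = (1 - th)%:E * mu (S i).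
Hypothesis mphi : measurable_fun setT phi.
Hypotheses (mg : measurable_fun setT g) (mh : measurable_fun setT h).
Hypotheses (g0 : forall x, (0 <= g x)%R) (h0 : forall x, (0 <= h x)%R).
Hypothesis gP : forall i x t, (i < N)%N -> S i x -> K i t ->
  (edist x (phi t) `^ p <= g x)%R.
Hypothesis hP : forall x t, (edist x (phi t) `^ p <= h x)%R.

(** The second factor of the coupling is pushed forward by [phi]. The near-diagonal part costs at
    most [g], and the rest, of mass [th], at most [h]; both bounds depend on [x] alone, so only the
    first marginals enter. *)
Lemma wasserstein_le : (0 <= p)%R ->
  wasserstein p mu (pushforward nu phi) <=
  ((1 - th)%:E * \int[mu]_x (g x)%:E + th%:E * \int[mu]_x (h x)%:E) `^ p^-1.
Proof.
move=> p0.
have [z1 [z2 [z1E z2E zE z1U]]] := near_diagonal_coupling mS mK tS tK covS nuK.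
pose z : {measure set (Rd R d * measurableTypeR R) -> \bar R} := measure_add z1 z2.
have zA A : z A = z1 A + z2 A by exact: measure_addE.
have zT : z setT = 1.
  by rewrite zA -setXTT zE// probability_setT.
(* [z] is its own normalization, which bundles it as a probability. *)
pose P : probability (Rd R d * measurableTypeR R)%type R := mnormalize z (mu \x nu).
have PE A : P A = z A.
  by rewrite /P/= /mnormalize zT onee_eq0/= invr1 mule1.
pose F (w : Rd R d * measurableTypeR R) := (w.1, phi w.2).
have mF : measurable_fun setT F.
  apply/measurable_fun_pairP; split; first exact: measurable_fst.
  exact: (measurableT_comp mphi measurable_snd).
pose X : {RV P >-> (Rd R d * Rd R d)%type} := HB.pack F (isMeasurableFun.Build _ _ _ _ F mF).
have coup : coupling mu (pushforward nu phi) (distribution P X).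
  move=> A mA; rewrite /distribution /pushforward/=; split.
    rewrite (_ : X @^-1` _ = A `*` setT); last by rewrite setXT.
    rewrite [LHS]PE zA [X in X + _](z1E _ mA) [X in _ + X](z2E _ mA).
    rewrite -ge0_muleDl ?lee_fin ?subr_ge0//.
    by rewrite -EFinD subrK mul1e.
  rewrite (_ : X @^-1` _ = setT `*` (phi @^-1` A)); last by rewrite setTX.
  rewrite [LHS]PE zA; apply: zE.
  by rewrite -[X in measurable X]setTI; exact: mphi.
pose c (w : Rd R d * Rd R d) : \bar R := (edist w.1 w.2 `^ p)%:E.
have mc : measurable_fun setT c.
  apply/measurable_EFinP; apply: (measurableT_comp (measurable_powR p)).
  exact: measurable_edist measurable_fst measurable_snd.
have c0 w : 0 <= c w by rewrite lee_fin powR_ge0.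
apply: (@le_trans _ _ ((\int[distribution P X]_w c w) `^ p^-1)).
  by apply: ereal_inf_lbound; exists (distribution P X).
apply: gt0_ler_poweR; rewrite ?invr_ge0 ?in_itv/= ?leey ?andbT//.
  exact: integral_ge0.
  by rewrite adde_ge0// mule_ge0 ?lee_fin ?subr_ge0//; apply: integral_ge0 => x _; rewrite lee_fin.
rewrite ge0_integral_distribution//.
have mcX : measurable_fun setT (c \o X) by exact: (measurableT_comp mc).
rewrite (_ : \int[P]_x _ = \int[z]_x (c \o X) x); last by apply: eq_measure_integral => A _ _; exact: PE.
rewrite ge0_integral_measure_add//=.
have mgE : measurable_fun setT (EFin \o g) by exact/measurable_EFinP.
have mhE : measurable_fun setT (EFin \o h) by exact/measurable_EFinP.
have mfst (f : Rd R d -> \bar R) : measurable_fun setT f ->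
    measurable_fun setT (fun w : Rd R d * measurableTypeR R => f w.1).
  by move=> mf; apply: (measurableT_comp mf); exact: measurable_fst.
apply: leeD; last first.
  rewrite -(integral_marginal th0 z2E mhE)//.
  apply: ge0_le_integral => //.
    exact: (mfst (EFin \o h)).
  by move=> [x t] _; rewrite lee_fin; exact: hP.
have th10 : (0 <= 1 - th)%R by rewrite subr_ge0.
rewrite -(integral_marginal th10 z1E mgE)//.
set U := \big[setU/set0]_(i < N) (S i `*` K i).
have mU : measurable U by apply: bigsetU_measurable => i _; exact: measurableX.
rewrite -(setUv U) ge0_integral_setU//; [|exact: measurableC|by rewrite setUv|by apply/disj_setPS => w [Uw /(_ Uw)]].
rewrite [X in _ + X]null_set_integral ?adde0//; [|exact: measurableC|exact: measurable_funTS].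
apply: (@le_trans _ _ (\int[z1]_(w in U) (EFin \o g) w.1)).
  apply: ge0_le_integral => //.
  - exact: measurable_funTS.
  - exact: measurable_funTS (mfst _ mgE).
  move=> [x t]; rewrite /U -(bigcup_mkord N (fun i => S i `*` K i)).
  by move=> [i/= iN [Sx Kt]]; rewrite lee_fin; exact: gP iN Sx Kt.
rewrite setUv; apply: ge0_subset_integral => //; first exact: (mfst _ mgE).
by move=> *; rewrite lee_fin.
Qed.

End wasserstein_upper_bound.

(** * Quantiles of an atomless distribution *)

Section quantiles.
Context {R : realType} (nu : probability (measurableTypeR R) R).

Lemma measure_bigcup_le (F : nat -> set (measurableTypeR R)) (c : \bar R) :
  (forall n, measurable (F n)) -> nondecreasing_seq F ->
  (forall n, (nu (F n) <= c)%E) -> (nu (\bigcup_n F n) <= c)%E.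
Proof.
move=> mF ndF Fc; have mUF : measurable (\bigcup_n F n) by exact: bigcupT_measurable.
have cv := nondecreasing_cvg_mu (mu := nu) mF mUF ndF.
rewrite -(cvg_lim _ cv)//; apply: lime_le; first by apply/cvg_ex; eexists; exact: cv.
by near=> n; exact: Fc.
Unshelve. all: by end_near. Qed.

Hypothesis nu_ac : nu `<< (@lebesgue_measure R).

Let rays_nd (u : nat -> R) : {homo u : m n / (m <= n)%N >-> m <= n} ->
  nondecreasing_seq (fun n => `]-oo, u n]%classic : set (measurableTypeR R)).
Proof.
move=> ndu m n mn; apply/subsetPset => x /=; rewrite !in_itv/= => xm.
by rewrite (le_trans xm)// ndu.
Qed.

Let rays_ndC (u : nat -> R) : {homo u : m n / (m <= n)%N >-> n <= m} ->
  nondecreasing_seq (fun n => ~` `]-oo, u n]%classic : set (measurableTypeR R)).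
Proof.
move=> ndu m n mn; apply/subsetPset => x /=; rewrite !in_itv/= => xm.
by apply: contra_not xm => xn; rewrite (le_trans xn)// ndu.
Qed.

(** The quantile is the supremum of the points where the distribution function is at most [y].
    Continuity from below, applied to rays and to their complements, gives the two inequalities
    there. *)
Lemma quantile (y : R) : 0 < y < 1 -> exists x : R, nu `]-oo, x]%classic = y%:E.
Proof.
move=> /andP[y0 y1].
pose F x := nu `]-oo, x]%classic.
have mI x : measurable (`]-oo, x]%classic : set (measurableTypeR R)) by exact: measurable_itv.
have F_nd x x' : x <= x' -> (F x <= F x')%E.
  move=> xx'; rewrite /F le_measure ?inE// => t /=; rewrite !in_itv/=.
  by move=> /le_trans; exact.
have FC x : nu (~` `]-oo, x]%classic) = (1 - F x)%E by rewrite probability_setC.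
have Ffin x : F x \is a fin_num by exact: fin_num_measure.
have FCle x : (y%:E < F x)%E -> (nu (~` `]-oo, x]%classic) <= (1 - y)%:E)%E.
  rewrite FC -(fineK (Ffin x)) -EFinB lee_fin lte_fin; lra.
pose A := [set x | (F x <= y%:E)%E].
have A0 : A !=set0.
  apply/set0P/negP => /eqP A0.
  have : (nu (\bigcup_n ~` `]-oo, (- n%:R)%R]%classic) <= (1 - y)%:E)%E.
    apply: measure_bigcup_le.
    - by move=> n; exact: measurableC.
    - by apply: rays_ndC => m n mn; rewrite lerN2 ler_nat.
    - move=> n; apply: FCle; rewrite ltNge; apply/negP => h.
      by have : A (- n%:R) by []; rewrite A0.
  rewrite (_ : \bigcup_n _ = setT) ?probability_setT ?lee_fin; first lra.
  apply/seteqP; split=> // x _; exists (Num.bound `|x|) => //=.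
  rewrite in_itv/=; apply/negP; rewrite -ltNge ltrNl.
  by rewrite (le_lt_trans (ler_norm _))// ?normrN archi_boundP.
have Aub : has_ubound A.
  apply: contrapT => nub.
  have : (nu (\bigcup_n `]-oo, (n%:R)%R]%classic) <= y%:E)%E.
    apply: measure_bigcup_le => //.
    - by apply: rays_nd => m n mn; rewrite ler_nat.
    - move=> n; apply: contrapT => /negP; rewrite -ltNge => h; apply: nub.
      exists n%:R => x Ax; rewrite leNgt; apply/negP => /ltW/F_nd.
      by move=> /(lt_le_trans h); rewrite ltNge => /negP; apply.
  rewrite (_ : \bigcup_n _ = setT) ?probability_setT ?lee_fin; first lra.
  apply/seteqP; split=> // x _; exists (Num.bound `|x|) => //=.
  by rewrite in_itv/= ltW// (le_lt_trans (ler_norm _))// archi_boundP.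
exists (sup A); apply/eqP; rewrite eq_le; apply/andP; split.
  (* Absolute continuity enters here: the point [sup A] is null, and the rest is exhausted by rays
     of mass at most [y]. *)
  rewrite (_ : `]-oo, sup A]%classic = (\bigcup_n `]-oo, sup A - n.+1%:R^-1]%classic) `|` [set sup A]).
    have mU : measurable (\bigcup_n `]-oo, (sup A - n.+1%:R^-1)%R]%classic
      : set (measurableTypeR R)) by exact: bigcupT_measurable.
    have mQ : measurable ([set sup A] : set (measurableTypeR R)) by exact: measurable_set1.
    apply: (le_trans (measureU2 nu mU mQ)).
    have nuQ : nu [set sup A] = 0%E.
      by apply: (proj1 (null_content_dominatesP nu lebesgue_measure) nu_ac) => //; exact: lebesgue_measure_set1.
    rewrite [X in (_ + X)%E]nuQ adde0; apply: measure_bigcup_le => //.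
      apply: rays_nd => m n mn; rewrite lerD2l lerN2 lef_pV2 ?posrE ?ltr0n// ler_nat.
      by rewrite ltnS.
    move=> n.
    have [x Ax xA] : exists2 x, A x & sup A - n.+1%:R^-1 < x.
      by apply: sup_adherent; rewrite ?invr_gt0 ?ltr0n//; split.
    by rewrite (le_trans _ Ax)// F_nd// ltW.
  apply/seteqP; split => x /=.
    rewrite in_itv/= le_eqVlt => /orP[/eqP ->|xs]; [by right|left].
    have [n xn] := ltr_add_invr xs; exists n => //=.
    by rewrite in_itv/= lerBrDr ltW.
  move=> [[n _]|->]; rewrite /= !in_itv//= => /le_trans; apply.
  by rewrite gerBl invr_ge0.
have : (nu (\bigcup_n ~` `]-oo, (sup A + n.+1%:R^-1)%R]%classic) <= (1 - y)%:E)%E.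
  apply: measure_bigcup_le.
  - by move=> n; exact: measurableC.
  - apply: rays_ndC => m n mn; rewrite lerD2l lef_pV2 ?posrE ?ltr0n// ler_nat.
    by rewrite ltnS.
  - move=> n; apply: FCle; rewrite ltNge; apply/negP => h.
    have /(ub_le_sup Aub) : A (sup A + n.+1%:R^-1) by [].
    by rewrite gerDl leNgt invr_gt0 ltr0n.
rewrite (_ : \bigcup_n _ = ~` `]-oo, sup A]%classic).
  rewrite FC -[in X in X -> _](fineK (Ffin (sup A))) -EFinB lee_fin => h.
  by rewrite -/(F (sup A)) -(fineK (Ffin (sup A))) lee_fin; lra.
apply/seteqP; split => x /=.
  move=> [n _]/=; rewrite !in_itv/= => /negP; rewrite -ltNge => h.
  apply/negP; rewrite -ltNge (le_lt_trans _ h)// lerDl invr_ge0//.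
rewrite in_itv/= => /negP; rewrite -ltNge => /ltr_add_invr[n h].
by exists n => //=; rewrite in_itv/=; apply/negP; rewrite -ltNge.
Qed.

(** Levels in (0, 1) are cut into intervals from [ya i] to [yb i], of length [(1 - th) * w i],
    separated by gaps of length [th / N]. The quantile function carries the former to the steps and
    the latter to the transition intervals. *)
Lemma quantile_intervals (w : nat -> R) (N : nat) (th : R) : (0 < N)%N -> 0 < th < 1 ->
  (forall i, 0 <= w i) -> (forall i, (N <= i)%N -> w i = 0) ->
  \sum_(i < N) w i = 1 ->
  exists (a b : nat -> R) (K : nat -> set (measurableTypeR R)),
    [/\ forall i, b i < a i, forall i, measurable (K i), trivIset setT K,
        forall i, nu (K i) = ((1 - th) * w i)%:E &
        forall i t, K i t -> (i < N)%N /\ located N a b i.+1 t].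
Proof.
move=> N0 /andP[th0 th1] w0 wN w1.
have [Q QP] : exists Q : R -> R, forall y, 0 < y < 1 -> nu `]-oo, Q y]%classic = y%:E.
  have /choice[Q HQ] : forall y, exists x, 0 < y < 1 -> nu `]-oo, x]%classic = y%:E.
    move=> y; have [/quantile[x xy]|ny] := boolP (0 < y < 1); first by exists x.
    by exists 0.
  by exists Q.
have Qlt y y' : 0 < y < 1 -> 0 < y' < 1 -> y < y' -> Q y < Q y'.
  move=> hy hy' yy'; rewrite ltNge; apply/negP => QQ.
  have : (nu `]-oo, Q y']%classic <= nu `]-oo, Q y]%classic)%E.
    rewrite le_measure ?inE//; try exact: measurable_itv.
    by move=> t /=; rewrite !in_itv/= => /le_trans; exact.
  by rewrite !QP// lee_fin leNgt yy'.
pose W i := \sum_(k < i) w k.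
have WS i : W i.+1 = W i + w i by rewrite /W big_ord_recr.
have W_nd i j : (i <= j)%N -> W i <= W j.
  move=> /subnKC <-; elim: (j - i)%N => [|k IH]; first by rewrite addn0.
  by rewrite addnS WS (le_trans IH)// lerDl.
have W_ge0 i : 0 <= W i by apply: sumr_ge0.
have W_le1 i : (i <= N)%N -> W i <= 1 by move=> iN; rewrite -w1; exact: W_nd.
(* Each step receives, besides its mass [(1 - th) * w i], a positive mass
   [th / N], half on each side: even the steps of weight zero are separated. *)
pose e i : R := th * (i%:R + 2^-1) / N%:R.
have Nr0 : 0 < N%:R :> R by rewrite ltr0n.
have e0 i : 0 < e i by rewrite /e divr_gt0// mulr_gt0// ltr_wpDl// invr_gt0.
have e1 i : (i < N)%N -> e i < th.
  move=> iN; rewrite /e ltr_pdivrMr// ltr_pM2l//.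
  have : i%:R + 1 <= N%:R :> R by rewrite natr1 ler_nat.
  by lra.
have e_lt i j : (i < j)%N -> e i < e j.
  move=> ij; rewrite /e ltr_pM2r ?invr_gt0// ltr_pM2l// ltrD2r ltr_nat//.
pose ya i := (1 - th) * W i + e i.
pose yb i := (1 - th) * W i.+1 + e i.
have ya01 i : (i < N)%N -> 0 < ya i < 1.
  move=> iN; rewrite /ya; apply/andP; split.
    by rewrite ltr_wpDl// mulr_ge0// subr_ge0 ltW.
  have := e1 i iN; have : (1 - th) * W i <= (1 - th) * 1.
    by rewrite ler_pM2l ?subr_gt0// W_le1// ltnW.
  by lra.
have yb01 i : (i < N)%N -> 0 < yb i < 1.
  move=> iN; rewrite /yb; apply/andP; split.
    by rewrite ltr_wpDl// mulr_ge0// subr_ge0 ltW.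
  have := e1 i iN; have : (1 - th) * W i.+1 <= (1 - th) * 1.
    by rewrite ler_pM2l ?subr_gt0// W_le1.
  by lra.
have ya_lt i j : (i < j)%N -> ya i < ya j.
  move=> ij; apply: ler_ltD; last exact: e_lt.
  by rewrite ler_pM2l ?subr_gt0// W_nd// ltnW.
have yb_lt i j : (i < j)%N -> yb i < yb j.
  move=> ij; apply: ler_ltD; last exact: e_lt.
  by rewrite ler_pM2l ?subr_gt0// W_nd// ltnS ltnW.
(* Transition [i] precedes step [i], so on [K i] the first [i.+1] transitions have been passed. The
   values of [b] at 0 and of [a] from [N] on are defaults that ensure [b i < a i]. *)
pose b i := if i is j.+1 then Q (yb j) else Q (ya 0%N) - 1.
pose a i := if (i < N)%N then Q (ya i) else b i + 1.
pose K i : set (measurableTypeR R) :=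
  if (i < N)%N then `]a i, b i.+1]%classic else set0.
have ba i : b i < a i.
  rewrite /a; case: ifP => iN; last by rewrite ltrDl.
  case: i iN => [|i] iN; first by rewrite /b; lra.
  apply: Qlt; [by apply: yb01; exact: ltnW|exact: ya01|].
  by rewrite /yb /ya ltrD2l e_lt.
have Kloc i t : K i t -> (i < N)%N /\ located N a b i.+1 t.
  rewrite /K; case: ifP => // iN; rewrite /= in_itv/= => /andP[ait tbi].
  split=> // j jN; split=> [|ij].
    rewrite ltnS leq_eqVlt => /orP[/eqP ->|ji]; first exact: ltW.
    apply: le_trans (ltW ait); rewrite /a iN jN.
    by apply/ltW/Qlt; [exact: ya01|exact: ya01|exact: ya_lt].
  apply: (le_trans tbi); case: j jN ij => // j jN; rewrite ltnS leq_eqVlt.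
  move=> /orP[/eqP ->//|ij]; apply/ltW/Qlt; [exact: yb01|by apply/yb01/ltnW|exact: yb_lt].
exists a, b, K; split => //.
- by move=> i; rewrite /K; case: ifP => // _; exact: measurable_itv.
- apply: ltn_trivIset => j i ij; apply/seteqP; split=> // t [Kit Kjt].
  have [iN li] := Kloc _ _ Kit; have [jN lj] := Kloc _ _ Kjt.
  have [_ /(_ ij) tbj] := li j jN; have [/(_ (ltnSn j)) ajt _] := lj j jN.
  by have := lt_le_trans (ba j) (le_trans ajt tbj); rewrite ltxx.
- move=> i; rewrite /K; case: ifPn => iN; last first.
    by rewrite measure0 wN ?mulr0// leqNgt.
  have yab : ya i <= yb i.
    by rewrite /ya /yb lerD2r ler_pM2l ?subr_gt0// WS lerDl.
  have aib : a i <= b i.+1.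
    rewrite /a iN /b; move: yab; rewrite le_eqVlt => /orP[/eqP ->//|lt].
    by apply/ltW/Qlt; [exact: ya01|exact: yb01|].
  have mI x : measurable (`]-oo, x]%classic : set (measurableTypeR R)) by exact: measurable_itv.
  have Fb : nu `]-oo, b i.+1]%classic = (yb i)%:E by apply: QP; exact: yb01.
  have Fa : nu `]-oo, a i]%classic = (ya i)%:E by rewrite /a iN; apply: QP; exact: ya01.
  have D : (nu `]-oo, b i.+1]%classic = nu `]a i, b i.+1]%classic + nu `]-oo, a i]%classic)%E.
    rewrite [LHS](measureDI nu (mI (b i.+1)) (mI (a i))).
    rewrite (_ : _ `&` _ = `]-oo, a i]%classic); last first.
      apply/seteqP; split=> t /=; rewrite !in_itv/=; first by case.
      by move=> ta; split=> //; exact: le_trans aib.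
    rewrite (_ : _ `\` _ = `]a i, b i.+1]%classic); last first.
      apply/seteqP; split=> t /=; rewrite !in_itv/=.
        by move=> [-> /negP]; rewrite -ltNge => ->.
      by move=> /andP[at_ ->]; split=> //; apply/negP; rewrite -ltNge.
    by [].
  move: D; rewrite Fb Fa.
  set x := nu _; have : x \is a fin_num by apply: fin_num_measure; exact: measurable_itv.
  move=> /fineK <-; rewrite -EFinD => -[] h; congr EFin.
  by move: h; rewrite /yb /ya WS; lra.
Qed.

End quantiles.

(** * Covering numbers and upper dimension *)

Section covering.
Context {R : realType} {d : nat} (mu : probability (Rd R d) R).
Local Open Scope ereal_scope.

(** The limit superior is an infimum over neighbourhoods, one of which keeps the quotient below [s];
    for [e < 1] the denominator is positive and can be cleared. *)
Lemma upper_dim_covering r s : upper_dim r mu < s%:E -> exists2 e0 : R, (0 < e0)%R &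
  forall e : R, (0 < e < e0)%R ->
    measure_covering_number mu e (e `^ r) < (e `^ (- s))%:E.
Proof.
move=> /ereal_inf_lt[_ [V V0 <-]] Vs.
have [e1 /= e10 Ve1] : nbhs_ball (0%R : R) (fun x => (0 < x)%R -> V x).
  by apply/nbhs_ballP; exact: V0.
exists (Num.min e1 1%R); first by rewrite lt_min e10 ltr01.
move=> e /andP[e0]; rewrite lt_min => /andP[ee1 elt1].
have Ve : V e by apply: Ve1 => //; rewrite /ball/= sub0r normrN gtr0_norm.
set n := measure_covering_number _ _ _.
have lne0 : (ln e < 0)%R by rewrite ln_lt0// e0.
have ln20 : (0 < ln 2 :> R)%R by rewrite ln_gt0// ltr1n.
have D0 : (0 < - (ln e / ln 2))%R by rewrite -mulNr divr_gt0// oppr_gt0.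
have : (lne n / (ln 2)%:E) / (- (ln e / ln 2))%:E < s%:E.
  by apply: le_lt_trans Vs; apply: ereal_sup_ubound; exists e.
rewrite !inver !gt_eqF// lte_pdivrMr// lte_pdivrMr// -!EFinM.
rewrite (_ : (_ * _ * _)%R = (- s * ln e)%R); last by field; rewrite gt_eqF.
case: n => [n|//|_]; last by rewrite ltNyr.
have [n0|n0] := leP n 0%R.
  by move=> _; rewrite lte_fin (le_lt_trans n0)// powR_gt0.
by rewrite lne_EFin// lte_fin -(ln_powR) ltr_ln ?posrE ?powR_gt0.
Qed.

Lemma covering_lt e delta (k : R) : measure_covering_number mu e delta < k%:E ->
  exists (A : set (Rd R d)) (m : nat),
    [/\ measurable A, (1 - delta)%:E <= mu A, covered_by e A m & (m%:R < k)%R].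
Proof.
move=> /ereal_inf_lt[_ [A [mA muA] <-]] /ereal_inf_lt[_ [m Am <-]].
by rewrite lte_fin => mk; exists A, m.
Qed.

(** If [s <= 0], then for small [e] fewer than one ball would suffice, and a set of measure at least
    [1 - e^r > 0] would be empty. *)
Lemma upper_dim_gt0 r s : (0 < r)%R -> upper_dim r mu < s%:E -> (0 < s)%R.
Proof.
move=> r0 /upper_dim_covering[e0 e00 H].
pose e := (Num.min e0 1 / 2)%R.
have m0 : (0 < Num.min e0 1)%R by rewrite lt_min e00 ltr01.
have e_gt0 : (0 < e)%R by rewrite /e divr_gt0.
have e_lt : (e < Num.min e0 1)%R by rewrite /e; lra.
move: (e_lt); rewrite lt_min => /andP[ee0 e1].
have [|A [m [mA muA [c Ac] mk]]] := covering_lt (H e _); first by rewrite e_gt0.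
rewrite ltNge; apply/negP => s0.
have one_powR u : (1 `^ u)%R = 1%R :> R by rewrite powR1.
have : (e `^ (- s) <= 1)%R.
  by rewrite -(one_powR (- s)%R) ge0_ler_powR ?oppr_ge0 ?nnegrE// ltW.
move=> /(lt_le_trans mk); rewrite ltrn1 => m_lt1; have m0E : m = 0%N by apply/eqP; move: m_lt1; rewrite ?ltnS ?leqn0.
subst m.
have : mu A <= 0.
  rewrite (_ : A = set0) ?measure0//; apply/seteqP; split=> // x /Ac[[]].
  by [].
move=> /(le_trans muA); rewrite lee_fin subr_le0 leNgt => /negP; apply.
by rewrite -(one_powR r) gt0_ltr_powR// nnegrE ltW.
Qed.

Lemma measurable_eball c e : measurable (eball c e : set (Rd R d)).
Proof.
have mE : measurable_fun setT (fun x : Rd R d => edist c x).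
  by apply: measurable_edist; [exact: measurable_cst|exact: measurable_id].
rewrite (_ : eball c e = setT `&` (fun x => edist c x) @^-1` `]-oo, e[%classic).
  by apply: mE => //; exact: measurable_itv.
by rewrite setTI; apply/seteqP; split=> x /=; rewrite in_itv.
Qed.

(** Piece 0 is the complement of [A], with center 0, and ball [j] yields piece [j.+1], whence
    [m < N]. Each set loses what the earlier ones contain, which leaves piece 0 intact; indices
    beyond the balls get empty sets. *)
Lemma covered_partition e A m N : measurable A -> covered_by e A m -> (m < N)%N ->
  exists (S : nat -> set (Rd R d)) (c : nat -> Rd R d),
  [/\ (forall i, measurable (S i)) /\ trivIset setT S,
      \big[setU/set0]_(i < N) S i = setT, forall i, (N <= i)%N -> S i = set0,
      S 0%N = ~` A /\ c 0%N = [tuple 0%R | i < d] &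
      forall i x, (0 < i)%N -> S i x -> (edist x (c i) < e)%R].
Proof.
move=> mA [c Ac] mN.
pose E i := if i is j.+1 then
  (if insub j is Some k then A `&` eball (c k) e else set0) else ~` A.
have mE i : measurable (E i).
  case: i => [|i] /=; first exact: measurableC.
  by case: insubP => // k _ _; apply: measurableI => //; exact: measurable_eball.
have EN i : (m < i)%N -> E i = set0.
  by case: i => // i mi; rewrite /E insubF// ltnNge -ltnS mi.
exists (seqDU E), (fun i => if i is j.+1 then
  (if insub j is Some k then c k else [tuple 0%R | i < d]) else [tuple 0%R | i < d]).
split => //.
- by split; [move=> i; exact: seqDU_measurable|exact: trivIset_seqDU].
- rewrite -bigsetU_seqDU -(bigcup_mkord N E); apply/seteqP; split=> // x _.
  have [Ax|nAx] := pselect (A x); last by exists 0%N => //=; exact: leq_ltn_trans mN.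
  have [k _ kx] := Ac x Ax; exists k.+1 => /=.
    by rewrite (leq_ltn_trans _ mN)//.
  by rewrite insubT//= => km; split=> //; move: kx; congr eball; congr c; exact: val_inj.
- move=> i Ni; apply/seteqP; split=> // x Sx.
  have : E i x by exact: (@subset_seqDU _ E i x Sx).
  by rewrite EN// (leq_trans mN).
- by split=> //; rewrite /seqDU big_ord0 setD0.
move=> [//|i] x _ Sx; have : E i.+1 x by exact: (@subset_seqDU _ E i.+1 x Sx).
rewrite /=.
by case: insubP => // k _ _ [_]; rewrite edistC.
Qed.

End covering.

(** * Approximation by one network *)

Section one_network.
Context {R : realType} {d : nat} (mu : probability (Rd R d) R).

(** Up to [R0] the first term suffices; beyond it, [p - q <= 0] gives [u^(p-q) <= R0^(p-q)]. *)
Lemma powR_tail (u R0 p q : R) : 0 <= u -> 0 < R0 -> 0 <= p -> p <= q ->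
  u `^ p <= R0 `^ p + R0 `^ (p - q) * u `^ q.
Proof.
move=> u0 R00 p0 pq; have [uR|Ru] := leP u R0.
  apply: (@le_trans _ _ (R0 `^ p)); first by rewrite ge0_ler_powR// nnegrE ltW.
  by rewrite lerDl mulr_ge0// powR_ge0.
have u_gt0 : 0 < u by exact: lt_trans Ru.
apply: (@le_trans _ _ (R0 `^ (p - q) * u `^ q)); last by rewrite lerDr powR_ge0.
have -> : u `^ p = u `^ (p - q) * u `^ q.
  by rewrite -powRD ?subrK// (gt_eqF u_gt0)/= implybT.
rewrite ler_wpM2r ?powR_ge0// -opprB !powRN lef_pV2 ?posrE ?powR_gt0//.
by rewrite ge0_ler_powR ?subr_ge0 ?nnegrE// ltW.
Qed.

Lemma measurable_enorm_powR q : measurable_fun setT (fun x : Rd R d => enorm x `^ q).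
Proof. exact: (measurableT_comp (measurable_powR q) measurable_enorm). Qed.

Lemma measurable_moment_combination q (a0 a1 a2 : R) (D : set (Rd R d)) : measurable D ->
  measurable_fun setT (fun x : Rd R d => a0 + a1 * \1_D x + a2 * enorm x `^ q).
Proof.
move=> mD; apply: measurable_funD.
  apply: measurable_funD; first exact: measurable_cst.
  by apply: measurable_funM; [exact: measurable_cst|exact: measurable_indic].
by apply: measurable_funM; [exact: measurable_cst|exact: measurable_enorm_powR].
Qed.

Lemma integral_moment_combination q (M a0 a1 a2 : R) (D : set (Rd R d)) :
  measurable D -> 0 <= a0 -> 0 <= a1 -> 0 <= a2 ->
  (\int[mu]_x (enorm x `^ q)%:E = M%:E)%E ->
  (\int[mu]_x (a0 + a1 * \1_D x + a2 * enorm x `^ q)%:E =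
    a0%:E + a1%:E * mu D + (a2 * M)%:E)%E.
Proof.
move=> mD a00 a10 a20 ME.
have i1 : measurable_fun setT (fun x : Rd R d => (\1_D x : R)%:E).
  by apply/measurable_EFinP; exact: measurable_indic.
have i2 : measurable_fun setT (fun x : Rd R d => (enorm x `^ q)%:E).
  by apply/measurable_EFinP; exact: measurable_enorm_powR.
have m1 : measurable_fun setT (fun x : Rd R d => (a1%:E * (\1_D x : R)%:E)%E).
  exact: measurable_funeM.
have m2 : measurable_fun setT (fun x : Rd R d => (a2%:E * (enorm x `^ q)%:E)%E).
  exact: measurable_funeM.
have n1 (x : Rd R d) : setT x -> (0 <= (\1_D x : R)%:E)%E by rewrite lee_fin.
have n2 (x : Rd R d) : setT x -> (0 <= (enorm x `^ q)%:E)%E by rewrite lee_fin powR_ge0.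
have n0 (x : Rd R d) : setT x -> (0 <= a0%:E)%E by rewrite lee_fin.
have n1' (x : Rd R d) : setT x -> (0 <= a1%:E * (\1_D x : R)%:E)%E.
  by move=> Tx; rewrite mule_ge0// n1.
have n2' (x : Rd R d) : setT x -> (0 <= a2%:E * (enorm x `^ q)%:E)%E.
  by move=> Tx; rewrite mule_ge0// n2.
have m0 : measurable_fun setT (fun _ : Rd R d => a0%:E) by exact: measurable_cst.
have n01 (x : Rd R d) : setT x -> (0 <= a0%:E + a1%:E * (\1_D x : R)%:E)%E.
  by move=> Tx; rewrite adde_ge0 ?n1'.
have m01 : measurable_fun setT (fun x : Rd R d => (a0%:E + a1%:E * (\1_D x : R)%:E)%E).
  exact: emeasurable_funD.
transitivity (\int[mu]_x (a0%:E + a1%:E * (\1_D x : R)%:E + a2%:E * (enorm x `^ q)%:E))%E.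
  by apply: eq_integral => x _; rewrite !EFinD !EFinM.
rewrite ge0_integralD// ge0_integralD// integral_cst// [X in (_ * X)%E]probability_setT mule1.
by rewrite !ge0_integralZl// integral_indic// setIT ME EFinM.
Qed.

Variables (p q M : R).
Hypotheses (p1 : 1 <= p) (pq : p < q).
Hypothesis ME : (\int[mu]_x (enorm x `^ q)%:E = M%:E)%E.

(** In [3 + M], one unit comes from the balls, [1 + M] from the tail outside [A], and the last unit
    from the mass [th] outside the steps, each multiplied by [e^p]. *)
Lemma wasserstein_NN_le (nu : probability (measurableTypeR R) R) (e : R) A m W L B k :
  nu `<< (@lebesgue_measure R) -> 0 < e -> measurable A ->
  ((1 - e `^ (p * q / (q - p)))%:E <= mu A)%E -> covered_by e A m ->
  (m < B * (k * k))%N -> (0 < k)%N ->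
  ((d.+1).*2 + (k + k) <= W)%N -> ((d.+1).*2 + k.*2.*2 * d <= W)%N ->
  (3 * B + 2 <= L)%N ->
  (wasserstein_NN p mu W L nu <= (e * (3 + M) `^ p^-1)%:E)%E.
Proof.
move=> nu_ac e0 mA muA Am mN k0 Wk Wkd BL; set N := (B * (k * k))%N in mN.
have p0 : 0 < p by exact: lt_le_trans ltr01 p1.
have M0 : 0 <= M.
  by rewrite -lee_fin -ME; apply: integral_ge0 => x _; rewrite lee_fin powR_ge0.
have [S [c [[mS tS] covS SN [S0 c0] Sc]]] := covered_partition mA Am mN.
have N0 : (0 < N)%N by exact: leq_ltn_trans mN.
pose w i := fine (mu (S i)).
have muS i : mu (S i) = (w i)%:E by rewrite /w fineK// fin_num_measure.
have w0 i : 0 <= w i by exact: fine_ge0.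
have wN i : (N <= i)%N -> w i = 0 by move=> /SN Si; rewrite /w Si measure0.
have w1 : \sum_(i < N) w i = 1.
  apply: EFin_inj; rewrite -sumEFin -(probability_setT mu) -covS measure_bigsetU//.
  by apply: eq_bigr => i _; exact/esym/muS.
(* Step [j] comes after [j.+1] transitions, hence the shift; level 0, before the first transition,
   is 0 as the staircase requires. *)
pose C j (i : 'I_d) := if j is j'.+1 then (if (j' < N)%N then tnth (c j') i else 0) else 0.
pose Kc := \sum_(j < N) \sum_(i < d) `|tnth (c j) i|.
have Kc0 : 0 <= Kc by apply: sumr_ge0 => j _; exact: sumr_ge0.
have CK j i : `|C j i| <= Kc.
  case: j => [|j] /=; first by rewrite normr0.
  case: ifPn => [jN|_]; last by rewrite normr0.
  rewrite /Kc (bigD1 (Ordinal jN))//= (bigD1 i)//= -addrA lerDl addr_ge0//.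
    by apply: sumr_ge0.
  by apply: sumr_ge0 => ? _; apply: sumr_ge0.
pose Ke := Num.sqrt (d%:R * Kc ^+ 2).
have Ke0 : 0 <= Ke by exact: sqrtr_ge0.
pose H := 2 `^ p * (1 + Ke `^ p) + 2 `^ p * M.
have p2 : 0 < 2 `^ p :> R by rewrite powR_gt0.
have H0 : 0 < H.
  rewrite ltr_pwDl// ?mulr_ge0 ?(ltW p2)// mulr_gt0//.
  by rewrite ltr_pwDl// powR_ge0.
(* [H] is the integral of the crude bound [h] below. As [Ke] does not depend on [th], the cost of
   the transitions can be made at most [e^p]. *)
pose th := Num.min 2^-1 (e `^ p / H).
have th0 : 0 < th by rewrite lt_min invr_gt0 ltr0n divr_gt0// powR_gt0.
have th1 : th < 1 by rewrite gt_min; apply/orP; left; lra.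
have thH : th * H <= e `^ p.
  by rewrite -ler_pdivlMr// ge_min lexx orbT.
have th01 : 0 < th < 1 by rewrite th0.
have [a [b [K [ba mK tK nuK Kloc]]]] := quantile_intervals nu_ac N0 th01 w0 wN w1.
have [phi NNphi [phiK phiE]] := @NN_staircase R d N a b C ba (fun=> erefl) W L B k k Kc
  k0 erefl Wk Wkd BL CK.
have phic i t : K i t -> phi t = c i.
  move=> /Kloc[iN lt]; apply: eq_from_tnth => j.
  by rewrite (phiE _ _ _ lt) (minn_idPl iN) /C iN.
have enorm_phi t : enorm (phi t) <= Ke.
  rewrite ler_wsqrtr// -[d in d%:R]card_ord -sumr_const mulr_suml ler_sum// => i _.
  by rewrite mul1r -[leLHS]real_normK ?num_real// ler_pXn2r ?nnegrE.
(* This radius balances the two terms of [powR_tail]: [R0^p] times the bound on the mass outside [A]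
   is [e^p], and so is [R0^(p-q)]. *)
pose R0 := e `^ (- (p / (q - p))).
have R00 : 0 < R0 by rewrite powR_gt0.
have R0p : R0 `^ p * e `^ (p * q / (q - p)) = e `^ p.
  rewrite -powRrM -powRD ?(gt_eqF e0)/= ?implybT//; congr (_ `^ _); field.
  by rewrite subr_eq0 gt_eqF.
have R0pq : R0 `^ (p - q) = e `^ p.
  rewrite -powRrM; congr (_ `^ _); field.
  by rewrite subr_eq0 gt_eqF.
pose g (x : Rd R d) := e `^ p + R0 `^ p * \1_(S 0%N) x + R0 `^ (p - q) * enorm x `^ q.
(* The zero term brings [h] to the form of [integral_moment_combination]. *)
pose h (x : Rd R d) := 2 `^ p * (1 + Ke `^ p) + 0 * \1_set0 x + 2 `^ p * enorm x `^ q.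
have mg : measurable_fun setT g.
  exact: measurable_moment_combination.
have mh : measurable_fun setT h.
  exact: measurable_moment_combination.
have g0 x : 0 <= g x by rewrite /g !addr_ge0 ?mulr_ge0 ?powR_ge0.
have h0 x : 0 <= h x by rewrite /h mul0r addr0 addr_ge0 ?mulr_ge0 ?addr_ge0 ?powR_ge0.
have gP i x t : (i < N)%N -> S i x -> K i t -> edist x (phi t) `^ p <= g x.
  move=> iN Six Kit; rewrite (phic _ _ Kit); case: i iN Six Kit => [|i] iN Six Kit.
    rewrite c0 edist0 /g indicE mem_set// mulr1 -addrA.
    rewrite (le_trans (powR_tail _ R00 (ltW p0) (ltW pq)))// ?enorm_ge0//.
    by rewrite lerDr powR_ge0.
  rewrite /g -addrA (@le_trans _ _ (e `^ p))//.
    by rewrite ge0_ler_powR ?nnegrE ?edist_ge0// ltW//; exact: Sc Six.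
  by rewrite lerDl addr_ge0 ?mulr_ge0 ?powR_ge0.
have hP x t : edist x (phi t) `^ p <= h x.
  rewrite (le_trans (edist_powR_le _ _ (ltW p0)))// /h mul0r addr0 -mulrDr.
  rewrite ler_pM2l//.
  have : enorm x `^ p <= 1 + enorm x `^ q.
    have := powR_tail (enorm_ge0 x) ltr01 (ltW p0) (ltW pq).
    by rewrite !powR1 mul1r.
  have : enorm (phi t) `^ p <= Ke `^ p.
    by rewrite ge0_ler_powR ?nnegrE ?enorm_ge0// ltW.
  by lra.
apply: (@le_trans _ _ (wasserstein p mu (pushforward nu phi))).
  by apply: ereal_inf_lbound; exists phi.
have nuK' i : nu (K i) = ((1 - th)%:E * mu (S i))%E by rewrite nuK EFinM muS.
apply: (le_trans (wasserstein_le (ltW th0) (ltW th1) mS mK tS tK covS nuK'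
  (measurable_NN NNphi) mg mh g0 h0 gP hP (ltW p0))).
rewrite !(integral_moment_combination _ _ _ _ ME)//; try by
  rewrite ?mulr_ge0 ?addr_ge0 ?powR_ge0//.
rewrite mul0e adde0 muS.
rewrite (_ : (_ + _)%E = ((1 - th) * (e `^ p + R0 `^ p * w 0%N + R0 `^ (p - q) * M) +
  th * H)%:E) ?poweR_EFin ?lee_fin; last by rewrite /H !(EFinD, EFinM).
have wS0 : w 0%N <= e `^ (p * q / (q - p)).
  have := probability_setC mu mA; rewrite -S0 muS.
  have := muA; have : mu A \is a fin_num by exact: fin_num_measure.
  move=> /fineK <-; rewrite lee_fin => hA; rewrite -EFinB => -[->]; lra.
rewrite R0pq.
apply: (@le_trans _ _ ((e `^ p * (3 + M)) `^ p^-1)).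
  rewrite ge0_ler_powR ?invr_ge0 ?nnegrE ?(ltW p0)//.
  - rewrite addr_ge0 ?mulr_ge0 ?subr_ge0 ?(ltW th1) ?(ltW th0)//.
      by rewrite !addr_ge0 ?mulr_ge0 ?powR_ge0.
    by rewrite !addr_ge0 ?mulr_ge0 ?addr_ge0 ?powR_ge0.
  - by rewrite mulr_ge0 ?powR_ge0// addr_ge0.
  have : R0 `^ p * w 0%N <= e `^ p.
    by rewrite -[leRHS]R0p ler_wpM2l ?powR_ge0.
  set G := e `^ p + _ + _ => hG.
  have GE : G <= e `^ p * (2 + M) by rewrite /G; lra.
  have G0 : 0 <= G by rewrite !addr_ge0 ?mulr_ge0 ?powR_ge0.
  have : (1 - th) * G <= G by rewrite mulrBl mul1r gerBl mulr_ge0// ltW.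
  by rewrite -/H; lra.
rewrite powRM ?powR_ge0//; last by rewrite addr_ge0.
by rewrite -powRrM mulfV ?gt_eqF// powRr1// ltW.
Qed.

End one_network.

(** * Choice of the parameters *)

Section final.
Context {R : realType}.

(** In dimension 0 the bound of the theorem is 0. It is attained with a single piece and [th = 0],
    all distances being zero. *)
Lemma wasserstein_NN_dim0 (p : R) (mu : probability (Rd R 0) R)
    (nu : probability (measurableTypeR R) R) W L : 0 < p ->
  (wasserstein_NN p mu W L nu <= 0)%E.
Proof.
move=> p0.
pose phi (t : measurableTypeR R) : Rd R 0 := [tuple 0 | i < 0].
have NNphi : @NN R 0 W L phi.
  by exists (Output 0 0); split=> // x; apply: eq_from_tnth => -[].
apply: (@le_trans _ _ (wasserstein p mu (pushforward nu phi))).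
  by apply: ereal_inf_lbound; exists phi.
pose S (i : nat) : set (Rd R 0) := if i == 0%N then setT else set0.
pose K (i : nat) : set (measurableTypeR R) := if i == 0%N then setT else set0.
have mS i : measurable (S i) by rewrite /S; case: ifP.
have mK i : measurable (K i) by rewrite /K; case: ifP.
have tS : trivIset setT S.
  by apply: ltn_trivIset => -[//|n] m _; rewrite /S/= setI0.
have tK : trivIset setT K.
  by apply: ltn_trivIset => -[//|n] m _; rewrite /K/= setI0.
have covS : \big[setU/set0]_(i < 1) S i = setT by rewrite big_ord1.
have nuK i : nu (K i) = ((1 - 0)%:E * mu (S i))%E.
  by rewrite subr0 mul1e /K /S; case: ifP => _; rewrite ?probability_setT ?measure0.
have dist0 (x y : Rd R 0) : edist x y `^ p <= 0.
  by rewrite /Defs.edist /enorm big_ord0 sqrtr0 powR0// gt_eqF.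
have mc : measurable_fun setT (cst 0 : Rd R 0 -> R) by exact: measurable_cst.
have := @wasserstein_le R 0 mu nu 1 S K 0 phi p (cst 0) (cst 0) (lexx _) ler01 mS mK tS tK
  covS nuK (measurable_NN NNphi) mc mc
  (fun=> lexx _) (fun=> lexx _) (fun _ x t _ _ _ => dist0 x (phi t))
  (fun x t => dist0 x (phi t)) (ltW p0).
by rewrite integral0 !mule0 adde0 poweR0r// invr_eq0 gt_eqF.
Qed.

Lemma powR_large (g T : R) : 0 < g -> exists X0, forall X, X0 <= X -> T < X `^ g.
Proof.
move=> g0; exists ((`|T| + 1) `^ g^-1) => X XX.
apply: (@lt_le_trans _ _ (((`|T| + 1) `^ g^-1) `^ g)).
  rewrite -powRrM mulVf ?gt_eqF// powRr1 ?addr_ge0//.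
  by rewrite (le_lt_trans (ler_norm T))// ltrDl.
by rewrite ge0_ler_powR ?nnegrE ?powR_ge0// ?(ltW g0)// (le_trans _ XX)// powR_ge0.
Qed.

Lemma lte_between (x : \bar R) (s : R) : (x < s%:E)%E -> exists2 t, t < s & (x < t%:E)%E.
Proof.
case: x => [r|//|] xs; last by exists (s - 1); rewrite ?ltNyr//; lra.
by move: xs; rewrite lte_fin => rs; exists ((r + s) / 2); rewrite ?lte_fin; lra.
Qed.

(** Rounding costs bounded factors: [W <= 16 * d.+1 * k] and [L <= 6 * B], and 1536 is
    [16 ^ 2 * 6]. *)
Lemma network_capacity d W L : (8 * d.+1 <= W)%N -> (8 <= L)%N ->
  exists k B, [/\ (0 < k)%N, ((d.+1).*2 + (k + k) <= W)%N,
    ((d.+1).*2 + k.*2.*2 * d <= W)%N, (3 * B + 2 <= L)%N &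
    (W ^ 2 * L <= 1536 * d.+1 ^ 2 * (B * (k * k)))%N].
Proof.
move=> dW L8; pose k := (W %/ (8 * d.+1))%N; pose B := ((L - 2) %/ 3)%N.
have k0 : (0 < k)%N by rewrite /k divn_gt0.
have kW : (k * (8 * d.+1) <= W)%N by rewrite /k leq_divM.
have Wk : (W <= k * (16 * d.+1))%N.
  have : (W < k.+1 * (8 * d.+1))%N by rewrite ltn_ceil.
  nia.
have BL : (L <= 6 * B)%N by rewrite /B; lia.
exists k, B; split=> //; [nia|nia|rewrite /B; lia|].
have : (W ^ 2 * L <= (k * (16 * d.+1)) ^ 2 * (6 * B))%N.
  by rewrite leq_mul// leq_sqr.
by move=> /leq_trans; apply; rewrite !expnMn; lia.
Qed.

End final.

Theorem theorem2p4 (R : realType) :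
  exists C : R, C <= 384 /\
  forall (d : nat) (p q : R), 1 <= p -> p < q ->
  forall mu : probability (Rd R d) R, (moment q mu < +oo)%E ->
  forall s : R, (upper_dim (p * q / (q - p)) mu < s%:E)%E ->
  exists W0 L0 : nat,
  forall nu : probability (measurableTypeR R) R,
  nu `<< (@lebesgue_measure R) ->
  forall W L : nat, (W0 <= W)%N -> (L0 <= L)%N ->
  (wasserstein_NN p mu W L nu <=
   (C * d%:R `^ s^-1)%:E * (moment q mu `^ p + 1) `^ p^-1
     * ((W ^ 2 * L)%:R `^ (- s^-1))%:E)%E.
Proof.
exists 1; split; first by rewrite ler1n.
move=> d p q p1 pq mu momq s dims.
have p0 : 0 < p by exact: lt_le_trans ltr01 p1.
have q0 : 0 < q by exact: lt_trans pq.
have qp0 : 0 < q - p by rewrite subr_gt0.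
have s0 : 0 < s by apply: upper_dim_gt0 dims; rewrite divr_gt0// mulr_gt0.
case: d mu momq dims => [|d] mu momq dims.
  exists 0%N, 0%N => nu _ W L _ _.
  rewrite mul1r powR0 ?invr_eq0 ?gt_eqF// !mul0e.
  exact: wasserstein_NN_dim0.
pose I := (\int[mu]_x (enorm x `^ q)%:E)%E.
have I0 : (0 <= I)%E by apply: integral_ge0 => x _; rewrite lee_fin powR_ge0.
have Ioo : (I < +oo)%E by apply: lty_poweRy momq; rewrite invr_eq0 gt_eqF.
pose M := fine I.
have ME : I = M%:E by rewrite /M fineK// ge0_fin_numE.
have M0 : 0 <= M by exact: fine_ge0.
have [s' s's dims'] := lte_between dims.
have [e0 e00 He] := upper_dim_covering dims'.
(* This factor cancels the [(3 + M)^(1/p)] of [wasserstein_NN_le], so that the distance is at most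
   [X^(-1/s)] without any constant. *)
pose ka := (3 + M) `^ (- p^-1).
have ka0 : 0 < ka by rewrite powR_gt0// ltr_pwDl.
pose c : R := (1536 * d.+2 ^ 2)%:R.
have c0 : 0 < c by rewrite ltr0n muln_gt0 expn_gt0.
have si0 : 0 < s^-1 by rewrite invr_gt0.
(* [X1] will ensure [e < e0], and [X2] that the network has more steps than there are balls. *)
have [X1 HX1] := powR_large (ka / e0) si0.
have ss0 : 0 < 1 - s' / s by rewrite subr_gt0 ltr_pdivrMr// mul1r.
have [X2 HX2] := powR_large (ka `^ (- s') * c) ss0.
(* As [X] is at least [W], a large [W] passes both thresholds, and [L] only has to satisfy the
   condition of [network_capacity]. *)
exists (maxn (8 * d.+2) (Num.bound (Num.max `|X1| `|X2|))), 8%N => nu nu_ac W L.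
rewrite geq_max => /andP[W8 WX] L8.
have W1 : (0 < W)%N by apply: leq_trans W8; rewrite muln_gt0.
have L1 : (0 < L)%N by exact: leq_trans L8.
set X : R := (W ^ 2 * L)%:R.
have X0 : 0 < X by rewrite ltr0n muln_gt0 expn_gt0 W1 L1.
have WleX : W%:R <= X.
  by rewrite ler_nat -mulnn -mulnA leq_pmulr// muln_gt0 W1.
have maxX : Num.max `|X1| `|X2| <= X.
  apply: le_trans WleX; apply/ltW.
  apply: (@lt_le_trans _ _ (Num.bound (Num.max `|X1| `|X2|))%:R).
    by apply: archi_boundP; rewrite le_max normr_ge0.
  by rewrite ler_nat.
have /HX1 {}HX1 : X1 <= X.
  by apply: le_trans maxX; rewrite le_max ler_norm.
have /HX2 {}HX2 : X2 <= X.
  by apply: le_trans maxX; rewrite le_max ler_norm orbT.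
pose e := ka * X `^ (- s^-1).
have Xs0 : 0 < X `^ s^-1 by rewrite powR_gt0.
have e_gt0 : 0 < e by rewrite mulr_gt0// powR_gt0.
have e_lt : e < e0.
  by rewrite /e powRN ltr_pdivrMr// mulrC -ltr_pdivrMr.
have [|A [m [mA muA Am mk]]] := covering_lt (He e _); first by rewrite e_gt0.
have [k [B [k0 Wk Wkd BL cap]]] := network_capacity W8 L8.
(* Up to a constant, [c * e^(-s')] is [X^(s'/s)] with [s' / s < 1], hence at most [X] for large
   [X]. *)
have mN : (m < B * (k * k))%N.
  rewrite -(ltr_nat R) -(ltr_pM2l c0); apply: (@lt_le_trans _ _ X); last first.
    by rewrite -natrM ler_nat.
  apply: (@lt_le_trans _ _ (c * e `^ (- s'))); first by rewrite ltr_pM2l.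
  have -> : e `^ (- s') = ka `^ (- s') * X `^ (s' / s).
    rewrite /e powRM ?(ltW ka0) ?powR_ge0// -powRrM; congr (_ * _ `^ _).
    by rewrite mulrN mulNr opprK mulrC.
  have XE : X = X `^ (1 - s' / s) * X `^ (s' / s).
    by rewrite -powRD ?(gt_eqF X0) ?implybT// subrK powRr1// ltW.
  by rewrite mulrA [c * _]mulrC [leRHS]XE ler_wpM2r ?powR_ge0// ltW.
apply: (le_trans (wasserstein_NN_le p1 pq ME nu_ac e_gt0 mA muA Am mN k0 Wk Wkd BL)).
have -> : e * (3 + M) `^ p^-1 = X `^ (- s^-1).
  rewrite /e mulrAC /ka -powRD ?addNr ?powRr0 ?mul1r//.
  by rewrite (_ : 3 + M != 0) ?implybT// gt_eqF// ltr_pwDl.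
(* The remaining factors of the bound are at least 1, the dimension being positive. *)
rewrite -[leLHS]mul1e lee_pmul ?lee_fin ?powR_ge0//.
rewrite -[leLHS]mul1e lee_pmul ?lee_fin//.
  rewrite mul1r -[leLHS](powRr0 d.+1%:R) ler_powR ?ler1n// ltW//.
rewrite -[leLHS](poweR1r p^-1) gt0_ler_poweR ?invr_ge0 ?(ltW p0)//.
- by rewrite in_itv/= lee01 leey.
- by rewrite in_itv/= leey andbT adde_ge0// poweR_ge0.
by rewrite leeDr// poweR_ge0.
Qed.
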